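(* For any $\vec s\in\mathbb Z^k$ and $\vec r\in\mathbb Z_{>0}^k$, the function $\varepsilon\mapsto Z(\vec s;\vec r;\varepsilon)$ (defined for $\mathrm{Re}\,\varepsilon<0$) lies in $\mathbb C\{\{\varepsilon,\varepsilon^{-1}\}[\ln(-\varepsilon)]$. If moreover $\vec s\in\mathbb Z_{\le0}^k$, then it lies in $\mathbb C\{\{\varepsilon,\varepsilon^{-1}\}$.
   Context: $Z(\vec s;\vec r;\varepsilon)=\sum_{n_1>\dots>n_k>0}e^{\varepsilon(n_1r_1+\dots+n_kr_k)}n_1^{-s_1}\cdots n_k^{-s_k}$ for $\mathrm{Re}\,\varepsilon<0$. $\mathbb C\{\{\varepsilon,\varepsilon^{-1}\}$ is the algebra of convergent Laurent series at $0$ (with finitely many negative powers), regarded as germs of functions meromorphic near $\varepsilon=0$; $\ln$ is the branch analytic on $\mathbb C\setminus(-\infty,0]$. Membership means that on some region of $\{\mathrm{Re}\,\varepsilon<0\}$ near $0$, $Z$ agrees with $\sum_{n=0}^M a_n(\varepsilon)\ln^n(-\varepsilon)$ for some $a_n\in\mathbb C\{\{\varepsilon,\varepsilon^{-1}\}$. *)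

(* Defs.v *)
From mathcomp Require Import all_boot all_order all_algebra.
From mathcomp Require Import all_classical all_reals all_analysis.
From mathcomp Require Export complex.

Set Implicit Arguments.
Unset Strict Implicit.
Unset Printing Implicit Defensive.

Import Order.TTheory GRing.Theory Num.Theory ComplexField.
Local Open Scope ring_scope.
Local Open Scope complex_scope.

Section Defs.
Variable R : realType.

Definition cexp (z : R[i]) : R[i] :=
  (expR (complex.Re z))%:C * ((cos (complex.Im z)) +i* (sin (complex.Im z))).

Definition carg (w : R[i]) : R :=
  let x := complex.Re w in let y := complex.Im w in
  if 0 < x then atan (y / x)
  else if x < 0 then (if 0 <= y then atan (y / x) + pi else atan (y / x) - pi)
  else if 0 < y then pi / 2 else if y < 0 then - (pi / 2) else 0.

Definition clog (w : R[i]) : R[i] :=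
  (ln (Num.sqrt (complex.Re w ^+ 2 + complex.Im w ^+ 2))) +i* (carg w).

Definition cvgC (u : nat -> R[i]) (l : R[i]) : Prop :=
  forall e : R, 0 < e -> exists N : nat, forall n : nat, (N <= n)%N ->
    `|u n - l| < e%:C.

Definition Zpartial (k : nat) (s : 'I_k -> int) (r : 'I_k -> nat)
    (eps : R[i]) (N : nat) : R[i] :=
  \sum_(n : {ffun 'I_k -> 'I_N.+1} |
          [forall i : 'I_k, forall j : 'I_k, (i < j)%N ==> (n j < n i)%N]
          && [forall i : 'I_k, (0 < n i)%N])
     cexp (eps * (\sum_(i < k) (n i * r i)%N%:R))
       * \prod_(i < k) (((n i)%:R : R[i]) ^ (- s i)).

(* "Z(s;r;eps) = L": the multiple series converges to L (limit of the
   partial sums truncated at n_1 <= N; the series is absolutely convergent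
   for Re eps < 0, so this is its sum). *)
Definition Zsum_is (k : nat) (s : 'I_k -> int) (r : 'I_k -> nat)
    (eps L : R[i]) : Prop :=
  cvgC (Zpartial s r eps) L.

Definition is_conv_laurent (a : R[i] -> R[i]) : Prop :=
  exists (N : nat) (c : nat -> R[i]) (rho : R), 0 < rho /\
    forall z : R[i], 0 < `|z| -> `|z| < rho%:C ->
      cvgC (fun m => \sum_(j < m) c j * z ^ (j%:Z - N%:Z)) (a z).

End Defs.

(* Main.v *)
Require Import Defs.
From mathcomp Require Import all_boot all_order all_algebra.
From mathcomp Require Import all_classical all_reals all_analysis.
From mathcomp Require Import complex ring lra zify.
Import Order.TTheory GRing.Theory Num.Theory ComplexField Normc.
Import numFieldNormedType.Exports.
Set Implicit Arguments.
Unset Strict Implicit.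
Unset Printing Implicit Defensive.
Local Open Scope ring_scope.
Local Open Scope complex_scope.

(* Induction on the depth [k], and for fixed [k] on [\sum_i |s_i|].
   If some [s_i <= 0], the sum over [n_i] alone, between its two neighbours, is
   elementary: [n^(-s_i) e^(eps r_i n)] has a primitive for the difference operator
   which is a combination of [e^(eps r_i n) n^p] with coefficients in
   [Q[e^eps, 1 / (e^(eps r_i) - 1)]], hence convergent Laurent series.  Summing by
   parts merges [r_i] into a neighbouring exponent and leaves sums of depth
   [k - 1] with positive exponents; if all [s_j <= 0] this property is preserved,
   so no logarithm ever appears.
   If all [s_i > 0], then [dZ/deps = \sum_i r_i Z(s - e_i)] has smaller weight.
   Laurent series in [eps] with powers of [ln (- eps)] have primitives of the same
   kind, and [Z] differs from such a primitive by a constant, because the partial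
   sums of the derivative converge uniformly on [Re eps <= - delta]. *)

(** The algebra is done on sums truncated at [N]: summation by parts and termwise differentiation
    are then finite identities, and inner sums occur with a moving bound anyway. Limits enter only
    once the depth has dropped or when integrating. Positivity of the [r_i] gives decay on
    [Re eps < 0], and it keeps [e^(eps r_i) - 1] away from zero there, with a simple zero at [0].
    Merging replaces [s_j] by [s_j - p] and may enlarge [|s_j|]; this is harmless, because the
    hypothesis for smaller depth carries no bound on the weight. Differentiation keeps the depth and
    is applied only when every [s_i > 0], where [|s_i - 1| < |s_i|]. A logarithm can only come from
    a residue met while integrating. Germs are handled through coefficient sequences with an
    explicit geometric majorant, so that products, inverses, derivatives and primitives reduce to
    estimates on coefficients. *)

Local Notation Re := complex.Re.
Local Notation Im := complex.Im.

(** * Complex norm and geometric convergence *)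

Lemma normcE_norm (R : realType) (z : R[i]) : `|z| = (normc z)%:C.
Proof. by []. Qed.

Lemma normc_ge0 (R : realType) (z : R[i]) : 0 <= normc z.
Proof. by case: z => a b; rewrite sqrtr_ge0. Qed.

Lemma normc_eq0 (R : realType) (z : R[i]) : (normc z == 0) = (z == 0).
Proof.
apply/eqP/eqP => [|->]; [exact: eq0_normc | exact: normc0].
Qed.

Lemma normc_gt0 (R : realType) (z : R[i]) : (0 < normc z) = (z != 0).
Proof. by rewrite lt_neqAle eq_sym normc_eq0 normc_ge0 andbT. Qed.

Lemma normcX (R : realType) (z : R[i]) n : normc (z ^+ n) = normc z ^+ n.
Proof.
elim: n => [|n IH]; first by rewrite !expr0 normc1.
by rewrite !exprS normcM IH.
Qed.

Lemma normc_real (R : realType) (x : R) : normc x%:C = `|x|.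
Proof. by rewrite /= expr0n addr0 sqrtr_sqr. Qed.

Lemma normc_nat (R : realType) n : normc (n%:R : R[i]) = n%:R.
Proof. by rewrite normcMn normc1. Qed.

Lemma normcB (R : realType) (x y : R[i]) : normc (x - y) = normc (y - x).
Proof. by rewrite -normcN opprB. Qed.

Lemma ler_normcB (R : realType) (x y : R[i]) : normc x - normc y <= normc (x - y).
Proof. by rewrite lerBlDr; apply: le_trans (le_normcD _ _); rewrite subrK. Qed.

Lemma normc_split (R : realType) (x y z : R[i]) :
  normc (x - z) <= normc (x - y) + normc (y - z).
Proof. by apply: le_trans (le_normcD _ _); rewrite addrA subrK. Qed.

Lemma Re_le_normc (R : realType) (z : R[i]) : `|Re z| <= normc z.
Proof. by have := normc_ge_Re z; rewrite normcE_norm lecR. Qed.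

Lemma Im_le_normc (R : realType) (z : R[i]) : `|Im z| <= normc z.
Proof.
case: z => a b /=; rewrite -sqrtr_sqr ler_sqrt ?lerDr ?addr_ge0 ?sqr_ge0 //.
Qed.

Lemma normc_le_ReIm (R : realType) (z : R[i]) : normc z <= `|Re z| + `|Im z|.
Proof.
case: z => a b /=; rewrite -[leRHS]ger0_norm ?addr_ge0 // -sqrtr_sqr.
rewrite ler_sqrt ?sqr_ge0 // sqrrD !real_normK ?num_real //.
by rewrite lerD2r lerDl mulrn_wge0 // mulr_ge0.
Qed.

Local Arguments normc : simpl never.

Lemma normc_sum (R : realType) n (F : 'I_n -> R[i]) :
  normc (\sum_(i < n) F i) <= \sum_(i < n) normc (F i).
Proof.
elim: n F => [|n IH] F; first by rewrite !big_ord0 normc0.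
by rewrite !big_ord_recr /=; apply: le_trans (le_normcD _ _) _; rewrite lerD2r.
Qed.

Lemma RecD (R : realType) (x y : R[i]) : Re (x + y) = Re x + Re y.
Proof. by case: x y => ? ? []. Qed.
Lemma ImcD (R : realType) (x y : R[i]) : Im (x + y) = Im x + Im y.
Proof. by case: x y => ? ? []. Qed.
Lemma RecB (R : realType) (x y : R[i]) : Re (x - y) = Re x - Re y.
Proof. by case: x y => ? ? []. Qed.
Lemma ImcB (R : realType) (x y : R[i]) : Im (x - y) = Im x - Im y.
Proof. by case: x y => ? ? []. Qed.
Lemma RecM (R : realType) (x y : R[i]) : Re (x * y) = Re x * Re y - Im x * Im y.
Proof. by case: x y => ? ? []. Qed.
Lemma ImcM (R : realType) (x y : R[i]) : Im (x * y) = Re x * Im y + Im x * Re y.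
Proof. by case: x y => ? ? []. Qed.

Lemma cvgCE (R : realType) (u : nat -> R[i]) l : cvgC u l <->
  forall e : R, 0 < e -> exists N : nat, forall n, (N <= n)%N -> normc (u n - l) < e.
Proof.
split=> H e e0; have [N HN] := H e e0; exists N => n /HN;
  by rewrite normcE_norm ltcR.
Qed.

(** With [t n] the tail of the geometric series, [x - t] increases, [x + t] decreases, and the first
    stays below the second. The supremum of [x - t] is squeezed between them, which gives the limit
    together with its rate. *)
Lemma geo_cvgR (R : realType) (x : nat -> R) (A q : R) : 0 <= q -> q < 1 ->
  (forall n, `|x n.+1 - x n| <= A * q ^+ n) ->
  exists L, forall n, `|x n - L| <= A / (1 - q) * q ^+ n.
Proof.
move=> q0 q1 H; set t := fun n => A / (1 - q) * q ^+ n.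
have q1' : 1 - q != 0 by rewrite subr_eq0 eq_sym lt_eqF.
have tS n : t n - t n.+1 = A * q ^+ n by rewrite /t exprS; field.
have A0 : 0 <= A by have := H 0%N; rewrite expr0 mulr1; exact: le_trans.
have t0 n : 0 <= t n.
  by rewrite /t mulr_ge0 ?exprn_ge0 // divr_ge0 // subr_ge0 ltW.
have inc m k : x m - t m <= x (m + k)%N - t (m + k)%N.
  elim: k => [|k IH]; first by rewrite addn0.
  apply: le_trans IH _; rewrite addnS.
  have := H (m + k)%N; have := tS (m + k)%N; rewrite ler_norml => <- /andP[]; lra.
have dec m k : x (m + k)%N + t (m + k)%N <= x m + t m.
  elim: k => [|k IH]; first by rewrite addn0.
  apply: le_trans IH; rewrite addnS.
  have := H (m + k)%N; have := tS (m + k)%N; rewrite ler_norml => <- /andP[]; lra.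
have yz m n : x m - t m <= x n + t n.
  have := inc m n; have := dec n m; rewrite (addnC n m).
  have := t0 (m + n)%N; lra.
pose S : set R := range (fun n => x n - t n).
have Sub n : ubound S (x n + t n) by move=> _ [m _ <-]; exact: yz.
have hS : has_sup S.
  split; first by exists (x 0%N - t 0%N); exists 0%N.
  by exists (x 0%N + t 0%N).
exists (sup S) => n; rewrite -/(t n) ler_norml.
have h1 : x n - t n <= sup S by apply: sup_upper_bound => //; exists n.
have h2 : sup S <= x n + t n by apply: sup_le_ub => //; case: hS.
apply/andP; split; lra.
Qed.

Lemma geo_cvg (R : realType) (u : nat -> R[i]) (A q : R) : 0 <= q -> q < 1 ->
  (forall n, normc (u n.+1 - u n) <= A * q ^+ n) ->
  exists L, forall n, normc (u n - L) <= 2 * A / (1 - q) * q ^+ n.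
Proof.
move=> q0 q1 H.
have [|a Ha] := @geo_cvgR _ (fun n => Re (u n)) A q q0 q1.
  by move=> n; rewrite -RecB; exact: le_trans (Re_le_normc _) (H n).
have [|b Hb] := @geo_cvgR _ (fun n => Im (u n)) A q q0 q1.
  by move=> n; rewrite -ImcB; exact: le_trans (Im_le_normc _) (H n).
exists (a +i* b) => n; apply: le_trans (normc_le_ReIm _) _.
rewrite RecB ImcB /=; apply: le_trans (lerD (Ha n) (Hb n)) _; rewrite le_eqVlt; apply/orP; left; apply/eqP; ring.
Qed.

Lemma exp_small (R : realType) (q e : R) : 0 <= q -> q < 1 -> 0 < e ->
  exists N, forall n, (N <= n)%N -> q ^+ n < e.
Proof.
move=> q0 q1 e0; have nq1 : `|q| < 1 by rewrite ger0_norm.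
have /cvgrPdist_lt /(_ e e0) [N _ HN] := cvg_expr nq1.
exists N => n /HN; rewrite sub0r normrN ger0_norm ?exprn_ge0 //.
Qed.

Lemma geo_small (R : realType) (q K e : R) : 0 <= q -> q < 1 -> 0 < e ->
  exists N, forall n, (N <= n)%N -> K * q ^+ n < e.
Proof.
move=> q0 q1 e0; have K0 : 0 < `|K| + 1 by rewrite ltr_wpDl.
have [N HN] := @exp_small R q (e / (`|K| + 1)) q0 q1 (divr_gt0 e0 K0).
exists N => n /HN; rewrite ltr_pdivlMr // mulrC; apply: le_lt_trans.
by rewrite ler_wpM2r ?exprn_ge0 // (le_trans (ler_norm _)) // lerDl.
Qed.

Lemma geo_zero (R : realType) (x K q : R) : 0 <= q -> q < 1 -> 
  (forall n, x <= K * q ^+ n) -> x <= 0.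
Proof.
move=> q0 q1 H; rewrite leNgt; apply/negP => x0.
have [N HN] := @geo_small R q K x q0 q1 x0.
by have := HN N (leqnn N); rewrite ltNge H.
Qed.

Lemma geo_uniq (R : realType) (S T : R[i]) (u : nat -> R[i]) (K K' : R) (q : R) :
  0 <= q -> q < 1 ->
  (forall n, normc (u n - S) <= K * q ^+ n) ->
  (forall n, normc (u n - T) <= K' * q ^+ n) -> S = T.
Proof.
move=> q0 q1 HS HT; apply/eqP; rewrite -subr_eq0 -normc_eq0 -[_ == _]/(_ == _).
rewrite eq_le normc_ge0 andbT; apply: (@geo_zero R _ (K + K') q) => // n.
rewrite mulrDl; apply: le_trans (normc_split _ (u n) _) _.
by apply: lerD; rewrite // normcB.
Qed.

Lemma geo_cvgC (R : realType) (S : R[i]) (u : nat -> R[i]) (K : R) (q : R) :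
  0 <= q -> q < 1 -> (forall n, normc (u n - S) <= K * q ^+ n) -> cvgC u S.
Proof.
move=> q0 q1 H; apply/cvgCE => e e0.
have [N HN] := @geo_small R q K e q0 q1 e0.
by exists N => n /HN; apply: le_lt_trans.
Qed.

Lemma cvgC_add (R : realType) (u v : nat -> R[i]) a b :
  cvgC u a -> cvgC v b -> cvgC (fun n => u n + v n) (a + b).
Proof.
move=> /cvgCE Hu /cvgCE Hv; apply/cvgCE => e e0.
have e2 : 0 < e / 2 by rewrite divr_gt0.
have [N HN] := Hu _ e2; have [M HM] := Hv _ e2.
exists (maxn N M) => n; rewrite geq_max => /andP[/HN h1 /HM h2].
rewrite opprD addrACA; apply: le_lt_trans (le_normcD _ _) _.
by rewrite [e]splitr ltrD.
Qed.

Lemma cvgC_scale (R : realType) (u : nat -> R[i]) a c :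
  cvgC u a -> cvgC (fun n => c * u n) (c * a).
Proof.
move=> /cvgCE Hu; apply/cvgCE => e e0.
have c0 : 0 < normc c + 1 by rewrite ltr_wpDl ?normc_ge0.
have [N HN] := Hu _ (divr_gt0 e0 c0); exists N => n /HN.
rewrite ltr_pdivlMr // -mulrBr normcM; apply: le_lt_trans.
by rewrite mulrC ler_wpM2l ?normc_ge0 // lerDl.
Qed.

Lemma cvgC_cst (R : realType) (c : R[i]) : cvgC (fun=> c) c.
Proof. by apply/cvgCE => e e0; exists 0%N => n _; rewrite subrr normc0. Qed.

Lemma eq_cvgC (R : realType) (u v : nat -> R[i]) a :
  u =1 v -> cvgC u a -> cvgC v a.
Proof. by move=> /funext ->. Qed.

Lemma cvgC_le (R : realType) (u : nat -> R[i]) a b K :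
  cvgC u a -> (forall n, normc (u n - b) <= K) -> normc (a - b) <= K.
Proof.
move=> /cvgCE Hu H; rewrite leNgt; apply/negP; rewrite -subr_gt0 => e0.
have [N /(_ N (leqnn N))] := Hu _ e0; apply/negP; rewrite -leNgt.
rewrite lerBlDr; apply: le_trans (normc_split _ (u N) _) _.
by rewrite normcB lerD2l H.
Qed.

(** * Germs of analytic functions at 0 *)

(* The single constant [B] bounds the coefficients and also encodes a radius:
   every estimate below is made for [normc z <= (8 * B)^-1]. *)
Definition geo_bounded (R : realType) (B : R) (c : nat -> R[i]) :=
  1 <= B /\ forall j, normc (c j) <= B ^+ j.+1.

Definition pspart (R : realType) (c : nat -> R[i]) (z : R[i]) (m : nat) : R[i] :=
  \sum_(j < m) c j * z ^+ j.

(** One fixed rate [1/2] for all series, so that values can be added, multiplied and compared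
    without keeping track of rates. *)
Definition is_psval (R : realType) (c : nat -> R[i]) (z S : R[i]) :=
  exists K, forall m, normc (pspart c z m - S) <= K * 2^-1 ^+ m.

(* Junk value [0] where the partial sums do not converge geometrically. *)
Definition psval (R : realType) (c : nat -> R[i]) (z : R[i]) : R[i] :=
  xget 0 [set S | is_psval c z S].

Lemma half_ge0 (R : realType) : 0 <= 2^-1 :> R. Proof. by rewrite invr_ge0. Qed.
Lemma half_lt1 (R : realType) : 2^-1 < 1 :> R. Proof. by rewrite invf_lt1 // ltr1n. Qed.
Arguments half_ge0 {R}.
Arguments half_lt1 {R}.

Lemma psval_eq (R : realType) (c : nat -> R[i]) z S : is_psval c z S -> psval c z = S.
Proof.
move=> HS; rewrite /psval; case: xgetP => [T _ [K' HT]|/(_ S)]; last by [].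
by have [K HK] := HS; apply: geo_uniq half_ge0 half_lt1 HT HK.
Qed.

Lemma geo_bounded_mono (R : realType) (B B' : R) c : B <= B' -> geo_bounded B c -> geo_bounded B' c.
Proof.
move=> BB' [B1 Hc]; split; first exact: le_trans BB'.
move=> j; apply: le_trans (Hc j) _; rewrite lerXn2r ?nnegrE //; lra.
Qed.

(** The rate [1/8] leaves room above the rate [1/2] of [is_psval]: Cauchy products need a spare
    factor [2^-i], and differentiation costs [(j+1)^2 <= 4^(j+1)], which turns [1/8] into exactly
    [1/2]. *)
Lemma geo_bounded_term (R : realType) (B : R) c z j : geo_bounded B c -> normc z <= (8 * B)^-1 ->
  normc (c j * z ^+ j) <= B * 8^-1 ^+ j.
Proof.
move=> [B1 Hc] Hz; have B0 : 0 < B by lra.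
rewrite normcM normcX.
have -> : B * 8^-1 ^+ j = B ^+ j.+1 * (8 * B)^-1 ^+ j.
  rewrite exprS -mulrA -exprMn (_ : B * (8 * B)^-1 = 8^-1) //; field; exact: lt0r_neq0.
by apply: ler_pM; rewrite ?normc_ge0 ?exprn_ge0 ?normc_ge0 // lerXn2r ?nnegrE ?normc_ge0
  // invr_ge0; lra.
Qed.

Lemma psval_spec (R : realType) (B : R) c z : geo_bounded B c -> normc z <= (8 * B)^-1 ->
  is_psval c z (psval c z).
Proof.
move=> gc hz; suff [S HS] : exists S, is_psval c z S by rewrite (psval_eq HS).
have [||m|S HS] := @geo_cvg R (pspart c z) B 2^-1; [exact: half_ge0|exact: half_lt1| |].
  rewrite /pspart big_ord_recr /= addrAC subrr add0r.
  apply: le_trans (geo_bounded_term _ gc hz) _; rewrite ler_wpM2l //; first by case: gc; lra.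
  by rewrite lerXn2r ?nnegrE ?invr_ge0 // lef_pV2 ?posrE // ler_nat.
by exists S, (2 * B / (1 - 2^-1)).
Qed.

Lemma is_psval_add (R : realType) (c d : nat -> R[i]) z S T :
  is_psval c z S -> is_psval d z T -> is_psval (fun j => c j + d j) z (S + T).
Proof.
move=> [K HK] [L HL]; exists (K + L) => m.
rewrite mulrDl; apply: le_trans (lerD (HK m) (HL m)).
apply: le_trans (le_normcD _ _); rewrite le_eqVlt; apply/orP; left; apply/eqP.
congr normc; rewrite /pspart (eq_bigr (fun j : 'I_m => c j * z ^+ j + d j * z ^+ j)).
  by rewrite big_split /= opprD addrACA.
by move=> j _; rewrite mulrDl.
Qed.

Definition pconv (R : realType) (c d : nat -> R[i]) (n : nat) : R[i] :=
  \sum_(i < n.+1) c i * d (n - i)%N.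

Lemma pspart_conv (R : realType) (c d : nat -> R[i]) z m :
  pspart (pconv c d) z m = \sum_(i < m) c i * z ^+ i * pspart d z (m - i).
Proof.
elim: m => [|m IH]; first by rewrite /pspart !big_ord0.
rewrite /pspart big_ord_recr /= -/(pspart _ _ _) IH.
have e (i : 'I_m.+1) : c i * z ^+ i * pspart d z (m.+1 - i) =
    c i * z ^+ i * pspart d z (m - i) + c i * d (m - i)%N * z ^+ m.
  have im : (i <= m)%N by rewrite -ltnS ltn_ord.
  rewrite subSn // /pspart big_ord_recr /= mulrDr; congr (_ + _).
  rewrite -[in z ^+ m](subnKC im) exprD; ring.
rewrite [RHS](eq_bigr _ (fun i _ => e i)) big_split /= -/(pspart _ _ _).
congr (_ + _); last by rewrite /pconv mulr_suml.
by rewrite big_ord_recr /= subnn /pspart big_ord0 mulr0 addr0.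
Qed.

Lemma sum_half (R : realType) n : \sum_(i < n) (2^-1 : R) ^+ i.+1 = 1 - 2^-1 ^+ n.
Proof.
elim: n => [|n IH]; first by rewrite big_ord0 expr0 subrr.
rewrite big_ord_recr /= IH exprS; set x := _ ^+ n; lra.
Qed.

Lemma sum_half_le (R : realType) n : \sum_(i < n) (2^-1 : R) ^+ i.+1 <= 1.
Proof. by rewrite sum_half gerBl exprn_ge0 // invr_ge0. Qed.

(** Replacing the inner partial sum in row [i] of [pspart_conv] by [T] costs at most
    [B 8^-i * L 2^-(m-i)], which is below [2 B L 2^-m * 2^-(i+1)]; the sum over [i] keeps the rate
    [2^-m]. *)
Lemma is_psval_mul (R : realType) (B : R) (c d : nat -> R[i]) z T :
  geo_bounded B c -> normc z <= (8 * B)^-1 -> is_psval d z T -> 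
  is_psval (pconv c d) z (psval c z * T).
Proof.
move=> gc hz [L HL]; have [K HK] := psval_spec gc hz.
have B1 : 1 <= B by case: gc.
exists (2 * B * L + K * normc T) => m.
have -> : pspart (pconv c d) z m - psval c z * T =
   \sum_(i < m) c i * z ^+ i * (pspart d z (m - i) - T) + (pspart c z m - psval c z) * T.
  rewrite pspart_conv; under [in RHS]eq_bigr do rewrite mulrBr.
  rewrite sumrB -mulr_suml -/(pspart c z m); ring.
apply: le_trans (le_normcD _ _) _; rewrite [leRHS]mulrDl; apply: lerD; last first.
  by rewrite normcM mulrAC ler_wpM2r ?normc_ge0.
apply: le_trans (normc_sum _) _.
have L0 : 0 <= L.
  by have := HL 0%N; rewrite expr0 mulr1; apply: le_trans; rewrite normc_ge0.
apply: (@le_trans _ _ (\sum_(i < m) (2 * B * L * 2^-1 ^+ m) * 2^-1 ^+ i.+1)); last first.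
  rewrite -mulr_sumr ler_piMr ?sum_half_le // !mulr_ge0 ?exprn_ge0 ?invr_ge0 //; lra.
apply: ler_sum => i _; rewrite normcM.
apply: le_trans (ler_pM (normc_ge0 _) (normc_ge0 _) (geo_bounded_term i gc hz) (HL _)) _.
have im : (i <= m)%N by rewrite ltnW.
rewrite exprS (_ : 2^-1 ^+ m = 2^-1 ^+ i * 2^-1 ^+ (m - i)); last by rewrite -exprD subnKC.
have -> : 8^-1 = 2^-1 * 2^-1 * 2^-1 :> R by rewrite -!invfM; congr (_^-1); ring.
rewrite !exprMn; set x := _ ^+ i; set y := _ ^+ (m - i).
have x0 : 0 <= x by rewrite exprn_ge0 // invr_ge0.
have y0 : 0 <= y by rewrite exprn_ge0 // invr_ge0.
have x1 : x <= 1 by rewrite exprn_ile1 // ?invr_ge0 // ltW // half_lt1.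
have -> : 2 * B * L * (x * y) * (2^-1 * x) = B * L * y * x * x by field.
have -> : B * (x * x * x) * (L * y) = (B * L * y * x * x) * x by ring.
by rewrite ler_piMr // !mulr_ge0 //; lra.
Qed.

Definition analytic0 (R : realType) (f : R[i] -> R[i]) := exists (B : R) c, geo_bounded B c /\
  forall z, normc z <= (8 * B)^-1 -> f z = psval c z.

Lemma rad_mono (R : realType) (B B' : R) (z : R[i]) : 1 <= B -> B <= B' ->
  normc z <= (8 * B')^-1 -> normc z <= (8 * B)^-1.
Proof.
by move=> h1 h2 /le_trans; apply; rewrite lef_pV2 ?posrE ?ler_wpM2l //; lra.
Qed.

Lemma analytic0_psval (R : realType) (B : R) c : geo_bounded B c -> analytic0 (psval c).
Proof. by move=> g; exists B, c. Qed.

Lemma geo_bounded_max (R : realType) (B B' : R) c d : geo_bounded B c -> geo_bounded B' d ->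
  geo_bounded (B * B') c /\ geo_bounded (B * B') d.
Proof.
move=> g g'; have [B1 _] := g; have [B1' _] := g'.
by split; [apply: geo_bounded_mono g|apply: geo_bounded_mono g']; rewrite ?ler_peMr ?ler_peMl //; lra.
Qed.

Lemma analytic0_common (R : realType) (f g : R[i] -> R[i]) : analytic0 f -> analytic0 g ->
  exists B c d, [/\ geo_bounded B c, geo_bounded B d &
   forall z, normc z <= (8 * B)^-1 -> f z = psval c z /\ g z = psval d z].
Proof.
move=> [B [c [gc Hc]]] [B' [d [gd Hd]]]; have [g1 g2] := geo_bounded_max gc gd.
exists (B * B'), c, d; split=> // z hz; have [B1 _] := gc; have [B1' _] := gd.
by split; [apply: Hc|apply: Hd]; apply: rad_mono hz; rewrite ?ler_peMr ?ler_peMl //; lra.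
Qed.

Lemma geo_bounded_of_bound (R : realType) (B A : R) (c : nat -> R[i]) : 1 <= B -> 1 <= A ->
  (forall j, normc (c j) <= A * B ^+ j.+1) -> geo_bounded (A * B) c.
Proof.
move=> B1 A1 H; split; first by rewrite mulr_ege1.
move=> j; apply: le_trans (H j) _; rewrite exprMn ler_wpM2r ?exprn_ge0 //; first lra.
by rewrite -{1}[A]expr1 ler_weXn2l.
Qed.

Lemma analytic0_add (R : realType) (f g : R[i] -> R[i]) : analytic0 f -> analytic0 g ->
  analytic0 (fun z => f z + g z).
Proof.
move=> hf hg; have [B [c [d [gc gd H]]]] := analytic0_common hf hg.
have [B1 Hc] := gc; have [_ Hd] := gd.
exists (2 * B), (fun j => c j + d j); split.
  apply: geo_bounded_of_bound => //; first by rewrite ler1n.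
  by move=> j; apply: le_trans (le_normcD _ _) _; rewrite mulr_natl mulr2n lerD.
move=> z hz; have hz' : normc z <= (8 * B)^-1 by apply: rad_mono hz; lra.
have [-> ->] := H z hz'; apply/esym/psval_eq.
by apply: is_psval_add; apply: psval_spec hz'.
Qed.

(** Each of the [n+1] products is at most [B^(n+2)]; [n+1 <= 2^(n+1)] and [n+2 <= 2(n+1)] absorb
    both into a power of [2 * B ^+ 2]. The same count gives the constant in [geo_bounded_pder]. *)
Lemma geo_bounded_conv (R : realType) (B : R) (c d : nat -> R[i]) :
  geo_bounded B c -> geo_bounded B d -> geo_bounded (2 * B ^+ 2) (pconv c d).
Proof.
move=> [B1 Hc] [_ Hd]; split; first by have := exprn_ege1 2 B1; lra.
move=> n; apply: le_trans (normc_sum _) _.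
apply: (@le_trans _ _ (\sum_(i < n.+1) B ^+ n.+2)).
  apply: ler_sum => i _; rewrite normcM.
  have in' : (i <= n)%N by rewrite -ltnS ltn_ord.
  have -> : n.+2 = (i.+1 + (n - i).+1)%N by rewrite addnS addSn subnKC.
  by rewrite exprD ler_pM ?normc_ge0.
rewrite sumr_const card_ord.
have -> : B ^+ n.+2 *+ n.+1 = n.+1%:R * B ^+ n.+2 by rewrite [RHS]mulr_natl.
rewrite exprMn -exprM; apply: ler_pM => //.
- by rewrite exprn_ge0 //; lra.
- by rewrite -natrX ler_nat ltnW // ltn_expl.
- by rewrite ler_weXn2l //; lia.
Qed.

Lemma analytic0_mul (R : realType) (f g : R[i] -> R[i]) : analytic0 f -> analytic0 g ->
  analytic0 (fun z => f z * g z).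
Proof.
move=> hf hg; have [B [c [d [gc gd H]]]] := analytic0_common hf hg.
have [B1 Hc] := gc; exists (2 * B ^+ 2), (pconv c d); split; first exact: geo_bounded_conv.
move=> z hz; have hz' : normc z <= (8 * B)^-1.
  by apply: rad_mono hz => //; rewrite expr2; nra.
have [-> ->] := H z hz'; apply/esym/psval_eq.
exact: is_psval_mul gc hz' (psval_spec gd hz').
Qed.

Lemma pspart0 (R : realType) (c : nat -> R[i]) m : pspart c 0 m.+1 = c 0%N.
Proof.
rewrite /pspart big_ord_recl expr0 mulr1 big1 ?addr0 // => i _.
by rewrite expr0n /= mulr0.
Qed.

Lemma psval0 (R : realType) (c : nat -> R[i]) : psval c 0 = c 0%N.
Proof.
apply: psval_eq; exists (normc (c 0%N)) => [[|m]].
  by rewrite /pspart big_ord0 sub0r normcN expr0 mulr1.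
by rewrite pspart0 subrr normc0 mulr_ge0 ?normc_ge0 // exprn_ge0 // invr_ge0.
Qed.

Lemma analytic0_cst (R : realType) (a : R[i]) : analytic0 (fun=> a).
Proof.
exists (1 + normc a), (fun j => if j == 0%N then a else 0); split.
  split=> [|[|j]] /=; rewrite ?lerDl ?normc_ge0 ?expr1 ?lerDr //.
  by rewrite normc0 exprn_ge0 // addr_ge0 ?normc_ge0.
move=> z _; apply/esym/psval_eq; exists (normc a) => [[|m]].
  by rewrite /pspart big_ord0 sub0r normcN expr0 mulr1.
rewrite /pspart big_ord_recl /= expr0 mulr1 big1; last by move=> i _; rewrite mul0r.
by rewrite addr0 subrr normc0 mulr_ge0 ?normc_ge0 // exprn_ge0 // invr_ge0.
Qed.

Lemma analytic0_id (R : realType) : analytic0 (fun z : R[i] => z).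
Proof.
exists 1, (fun j => if j == 1%N then 1 else 0); split.
  by split=> // [[|[|j]]] /=; rewrite ?normc0 ?normc1 ?exprn_ge0 ?expr1n.
move=> z; rewrite mulr1 => hz; apply/esym/psval_eq; exists 1 => [[|[|m]]]; rewrite /pspart.
- rewrite big_ord0 sub0r normcN expr0 mulr1; apply: le_trans hz _.
  by rewrite invf_le1 // ler1n.
- rewrite big_ord1 mul0r sub0r normcN expr1 mul1r; apply: le_trans hz _.
  by rewrite lef_pV2 ?posrE // ler_nat.
- rewrite !big_ord_recl /= mul0r add0r mul1r expr1 big1; last by move=> i _; rewrite mul0r.
  by rewrite addr0 subrr normc0 mulr_ge0 // exprn_ge0 // invr_ge0.
Qed.

Lemma analytic0_scale (R : realType) (f : R[i] -> R[i]) a : analytic0 f -> analytic0 (fun z => a * f z).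
Proof. by move=> hf; apply: analytic0_mul => //; apply: analytic0_cst. Qed.

Lemma analytic0_X (R : realType) (f : R[i] -> R[i]) n : analytic0 f -> analytic0 (fun z => f z ^+ n).
Proof.
move=> hf; elim: n => [|n IH].
  by rewrite (_ : (fun _ => _) = fun=> 1); [apply: analytic0_cst|apply/funext].
rewrite (_ : (fun _ => _) = fun z => f z * f z ^+ n); first exact: analytic0_mul.
by apply/funext => z; rewrite exprS.
Qed.

Lemma geo_bounded_shift (R : realType) (B : R) c : geo_bounded B c -> geo_bounded (B ^+ 2) (fun j => c j.+1).
Proof.
move=> [B1 Hc]; split; first by rewrite exprn_ege1.
move=> j; apply: le_trans (Hc _) _; rewrite -exprM ler_weXn2l //; lia.
Qed.

Lemma psval_shift (R : realType) (B : R) c z : geo_bounded B c -> normc z <= (8 * B ^+ 2)^-1 ->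
  psval c z = c 0%N + z * psval (fun j => c j.+1) z.
Proof.
move=> gc hz; have [K HK] := psval_spec (geo_bounded_shift gc) hz.
have [B1 Hc] := gc.
have K0 : 0 <= K.
  by have := HK 0%N; rewrite expr0 mulr1; apply: le_trans; rewrite normc_ge0.
apply: psval_eq; exists (normc (c 0%N) + normc z * normc (psval (fun j => c j.+1) z) + 2 * normc z * K).
move=> [|m].
  rewrite /pspart big_ord0 sub0r normcN expr0 mulr1; apply: le_trans (le_normcD _ _) _.
  by rewrite normcM lerDl !mulr_ge0 ?normc_ge0.
have -> : pspart c z m.+1 - (c 0%N + z * psval (fun j => c j.+1) z) =
   z * (pspart (fun j => c j.+1) z m - psval (fun j => c j.+1) z).
  rewrite /pspart big_ord_recl expr0 mulr1 opprD addrACA subrr add0r mulrBr mulr_sumr.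
  by congr (_ - _); apply: eq_bigr => i _; rewrite exprS mulrCA.
rewrite normcM; apply: le_trans (ler_wpM2l (normc_ge0 _) (HK m)) _.
have -> : normc z * (K * 2^-1 ^+ m) = 2 * normc z * K * 2^-1 ^+ m.+1 by rewrite exprS; field.
by rewrite ler_wpM2r ?exprn_ge0 ?invr_ge0 // lerDr addr_ge0 ?mulr_ge0 ?normc_ge0.
Qed.

(** Used to divide out the zero of [e^(rz) - 1] and to peel the lowest term off a pole. *)
Lemma analytic0_shift (R : realType) (f : R[i] -> R[i]) : analytic0 f ->
  exists2 g, analytic0 g & exists2 rho : R, 0 < rho &
    forall z, normc z < rho -> f z = f 0 + z * g z.
Proof.
move=> [B [c [gc H]]]; have [B1 Hc] := gc.
exists (psval (fun j => c j.+1)); first exact: analytic0_psval (geo_bounded_shift gc).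
have B2 : B <= B ^+ 2 by rewrite expr2; nra.
have B0 : 0 < (8 * B ^+ 2)^-1 by rewrite invr_gt0; lra.
exists (8 * B ^+ 2)^-1 => // z /ltW hz.
have h0 : normc (0 : R[i]) <= (8 * B)^-1 by rewrite normc0 invr_ge0; lra.
by rewrite (H z (rad_mono B1 B2 hz)) (H 0 h0) psval0; apply: psval_shift hz.
Qed.

(** Each coefficient of the reciprocal series depends on all earlier ones; keeping these in a list,
    latest first, makes the recursion structural. The constant coefficient of [c] is meant to be
    [1]. *)
Fixpoint invseq (R : realType) (c : nat -> R[i]) (n : nat) : seq R[i] :=
  if n is m.+1 then
    - (\sum_(i < n) c i.+1 * nth 0 (invseq c m) i) :: invseq c m
  else [:: 1].

Definition pinv (R : realType) (c : nat -> R[i]) (n : nat) : R[i] :=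
  head 0 (invseq c n).

Lemma nth_invseq (R : realType) (c : nat -> R[i]) n i : (i <= n)%N ->
  nth 0 (invseq c n) i = pinv c (n - i).
Proof.
elim: n i => [|n IH] [|i] //= hi.
by rewrite IH // subSS.
Qed.

Lemma pinvS (R : realType) (c : nat -> R[i]) n :
  pinv c n.+1 = - \sum_(i < n.+1) c i.+1 * pinv c (n - i).
Proof.
rewrite {1}/pinv /=; congr (- _); apply: eq_bigr => i _.
by rewrite nth_invseq // -ltnS.
Qed.

Lemma pconv_pinv (R : realType) (c : nat -> R[i]) : c 0%N = 1 ->
  pconv c (pinv c) = fun n => if n == 0%N then 1 else 0.
Proof.
move=> c0; apply/funext => [[|n]]; rewrite /pconv.
  by rewrite big_ord1 c0 /pinv /= mulr1.
by rewrite big_ord_recl c0 mul1r subn0 pinvS addrC subrr.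
Qed.

(** The induction needs the sharper bound [D^n]. Since [|c (i+1)| <= (B^2)^(i+1) = D^(i+1)
    2^-(i+1)], the recursion yields [D^(n+1)] times a sum of [2^-(i+1)], which is at most [1]: this
    is the purpose of the factor [2] in [D]. *)
Lemma geo_bounded_pinv (R : realType) (B : R) c : geo_bounded B c -> geo_bounded (2 * B ^+ 2) (pinv c).
Proof.
move=> [B1 Hc]; set D := 2 * B ^+ 2.
have D1 : 1 <= D by rewrite /D expr2; nra.
suff H n : normc (pinv c n) <= D ^+ n.
  by split=> // n; apply: le_trans (H n) _; rewrite ler_weXn2l.
have [m] := ubnP n; elim: m n => // m IH [|n] hn.
  by rewrite /pinv /= normc1 expr0.
rewrite pinvS normcN; apply: le_trans (normc_sum _) _.
apply: (@le_trans _ _ (\sum_(i < n.+1) D ^+ n.+1 * 2^-1 ^+ i.+1)); last first.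
  by rewrite -mulr_sumr ler_piMr ?sum_half_le // exprn_ge0 //; lra.
apply: ler_sum => i _; rewrite normcM.
have in' : (i <= n)%N by rewrite -ltnS ltn_ord.
have -> : D ^+ n.+1 * 2^-1 ^+ i.+1 = (B ^+ 2) ^+ i.+1 * D ^+ (n - i).
  rewrite -[in D ^+ n.+1](subnKC in') -addSn exprD mulrAC -exprMn; congr (_ ^+ _ * _).
  by rewrite /D; field.
apply: ler_pM; rewrite ?normc_ge0 //; last by apply: IH; lia.
by apply: le_trans (Hc _) _; rewrite -exprM ler_weXn2l //; lia.
Qed.

Lemma analytic0_inv (R : realType) (f : R[i] -> R[i]) : analytic0 f -> f 0 != 0 ->
  exists2 g, analytic0 g & exists2 rho : R, 0 < rho &
    forall z, normc z < rho -> f z * g z = 1.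
Proof.
move=> hf f0.
have [B [c [gc H]]] := analytic0_scale (f 0)^-1 hf.
have [B1 Hc] := gc.
have c0 : c 0%N = 1.
  by rewrite -psval0 -H ?mulVf // normc0 invr_ge0; lra.
have gi := geo_bounded_pinv gc.
exists (fun z => (f 0)^-1 * psval (pinv c) z); first exact: analytic0_scale (analytic0_psval gi).
have B2 : B <= 2 * B ^+ 2 by rewrite expr2; nra.
have B0 : 0 < (8 * (2 * B ^+ 2))^-1 by rewrite invr_gt0; lra.
exists (8 * (2 * B ^+ 2))^-1 => // z /ltW hz.
have hz' := rad_mono B1 B2 hz.
rewrite mulrA [f z * _]mulrC H // -(psval_eq (is_psval_mul gc hz' (psval_spec gi hz))).
rewrite pconv_pinv //; apply: psval_eq; exists 1 => [[|m]].
  by rewrite /pspart big_ord0 sub0r normcN normc1 expr0 mulr1.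
rewrite /pspart big_ord_recl /= expr0 mulr1 big1; last by move=> i _; rewrite mul0r.
by rewrite addr0 subrr normc0 mulr_ge0 // exprn_ge0 // invr_ge0.
Qed.

(** * Complex derivatives *)

Definition path_derive (R : realType) (phi : R -> R[i]) (t : R) (m : R[i]) :=
  is_derive t (1 : R) (fun u => Re (phi u)) (Re m) /\
  is_derive t (1 : R) (fun u => Im (phi u)) (Im m).

(* Real derivatives of the real and imaginary parts along every direction [w]; this
   weak form is all that the mean value inequality [MVT_C] needs. *)
Definition cderive (R : realType) (f : R[i] -> R[i]) (z l : R[i]) :=
  forall w, path_derive (fun t => f (z + t%:C * w)) 0 (l * w).

Lemma path_derive_cst (R : realType) (a : R[i]) t : path_derive (fun=> a) t 0.
Proof. by split; apply: is_derive_cst. Qed.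

Lemma path_derive_add (R : realType) (f g : R -> R[i]) t l m :
  path_derive f t l -> path_derive g t m -> path_derive (fun u => f u + g u) t (l + m).
Proof.
move=> [f1 f2] [g1 g2]; split.
- rewrite RecD (_ : (fun u => _) = (fun u => Re (f u)) + (fun u => Re (g u))).
    exact: is_deriveD.
  by apply/funext => u; rewrite RecD.
- rewrite ImcD (_ : (fun u => _) = (fun u => Im (f u)) + (fun u => Im (g u))).
    exact: is_deriveD.
  by apply/funext => u; rewrite ImcD.
Qed.

Lemma path_derive_mul (R : realType) (f g : R -> R[i]) t l m :
  path_derive f t l -> path_derive g t m -> path_derive (fun u => f u * g u) t (l * g t + f t * m).
Proof.
move=> [f1 f2] [g1 g2]; split.
- rewrite (_ : (fun u => _) = (fun u => Re (f u)) * (fun u => Re (g u))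
     - (fun u => Im (f u)) * (fun u => Im (g u))).
    apply: is_derive_eq; rewrite RecD !RecM /GRing.scale /=; ring.
  by apply/funext => u; rewrite RecM.
- rewrite (_ : (fun u => _) = (fun u => Re (f u)) * (fun u => Im (g u))
     + (fun u => Im (f u)) * (fun u => Re (g u))).
    apply: is_derive_eq; rewrite ImcD !ImcM /GRing.scale /=; ring.
  by apply/funext => u; rewrite ImcM.
Qed.

Lemma cderive_cst (R : realType) (a z : R[i]) : cderive (fun=> a) z 0.
Proof. by move=> w; rewrite mul0r; apply: path_derive_cst. Qed.

Lemma path_derive_line (R : realType) (z w : R[i]) t : path_derive (fun t : R => z + t%:C * w) t w.
Proof.
split.
- rewrite (_ : (fun u => _) = cst (Re z) + (id : R -> R) * cst (Re w)).
    apply: is_derive_eq; rewrite /GRing.scale /=; ring.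
  by apply/funext => u; rewrite RecD RecM /= mul0r subr0.
- rewrite (_ : (fun u => _) = cst (Im z) + (id : R -> R) * cst (Im w)).
    apply: is_derive_eq; rewrite /GRing.scale /=; ring.
  by apply/funext => u; rewrite ImcD ImcM /= mul0r addr0.
Qed.

Lemma cderive_id (R : realType) (z : R[i]) : cderive (fun z => z) z 1.
Proof. by move=> w; rewrite mul1r; apply: path_derive_line. Qed.

Lemma cderive_add (R : realType) (f g : R[i] -> R[i]) z l m :
  cderive f z l -> cderive g z m -> cderive (fun u => f u + g u) z (l + m).
Proof. by move=> Hf Hg w; rewrite mulrDl; apply: path_derive_add. Qed.

Lemma cderive_mul (R : realType) (f g : R[i] -> R[i]) z l m :
  cderive f z l -> cderive g z m -> cderive (fun u => f u * g u) z (l * g z + f z * m).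
Proof.
move=> Hf Hg w; have := path_derive_mul (Hf w) (Hg w); rewrite mul0r addr0.
by rewrite mulrDl mulrAC mulrA.
Qed.

Lemma cderive_eq (R : realType) (f : R[i] -> R[i]) z l m : cderive f z l -> l = m -> cderive f z m.
Proof. by move=> H <-. Qed.

Lemma cderive_scale (R : realType) (a : R[i]) (f : R[i] -> R[i]) z l :
  cderive f z l -> cderive (fun u => a * f u) z (a * l).
Proof.
by move=> Hf; apply: cderive_eq (cderive_mul (cderive_cst a z) Hf) _; rewrite mul0r add0r.
Qed.

Lemma cderive_sub (R : realType) (f g : R[i] -> R[i]) z l m :
  cderive f z l -> cderive g z m -> cderive (fun u => f u - g u) z (l - m).
Proof.
move=> Hf Hg; rewrite -mulN1r (_ : (fun u => _) = (fun u => f u + (-1) * g u)).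
  exact: cderive_add (cderive_scale _ _).
by apply/funext => u; rewrite mulN1r.
Qed.

Lemma cderive_sum (R : realType) n (f : 'I_n -> R[i] -> R[i]) z (l : 'I_n -> R[i]) :
  (forall i, cderive (f i) z (l i)) -> cderive (fun u => \sum_(i < n) f i u) z (\sum_(i < n) l i).
Proof.
elim: n f l => [|n IH] f l H.
  by rewrite big_ord0 (_ : (fun u => _) = fun=> 0); [apply: cderive_cst|apply/funext => u; rewrite big_ord0].
rewrite big_ord_recr (_ : (fun u => _) = fun u => \sum_(i < n) f (widen_ord (leqnSn n) i) u + f ord_max u).
  by apply: cderive_add => //; apply: IH.
by apply/funext => u; rewrite big_ord_recr.
Qed.

Lemma cderive_X (R : realType) (f : R[i] -> R[i]) z l n :
  cderive f z l -> cderive (fun u => f u ^+ n.+1) z (n.+1%:R * f z ^+ n * l).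
Proof.
move=> Hf; elim: n => [|n IH].
  by rewrite expr0 !mul1r (_ : (fun u => _) = f) //; apply/funext.
rewrite (_ : (fun u => _) = fun u => f u * f u ^+ n.+1); last first.
  by apply/funext => u; rewrite exprS.
apply: cderive_eq (cderive_mul Hf IH) _; rewrite [in RHS]exprS -[in RHS]natr1 -[in f z * _]natr1 exprS; ring.
Qed.

Lemma cderive_linear_comp (R : realType) (f : R[i] -> R[i]) a z l :
  cderive f (a * z) l -> cderive (fun u => f (a * u)) z (a * l).
Proof.
move=> H w; have := H (a * w); rewrite (mulrC a l) -mulrA.
rewrite (_ : (fun t : R => f (a * z + t%:C * (a * w))) = fun t => f (a * (z + t%:C * w))) //.
by apply/funext => t; rewrite mulrDr mulrCA.
Qed.

(** A quadratic remainder makes the difference quotient continuous at [x] with value [l], which is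
    Caratheodory's criterion. *)
Lemma is_derive_quad (R : realType) (phi : R -> R) (l K d x : R) : 0 < d ->
  (forall t, `|t - x| < d -> `|phi t - phi x - l * (t - x)| <= K * (t - x) ^+ 2) ->
  is_derive x (1 : R) phi l.
Proof.
move=> d0 H; apply/is_derive1_caratheodory.
exists (fun z => if z == x then l else (phi z - phi x) / (z - x)); split.
- move=> z; case: eqP => [->|/eqP]; first by rewrite !subrr mulr0.
  by rewrite -subr_eq0 => /divfK->.
- apply/cvgrPdist_lt => e e0; rewrite eqxx; apply/nbhs_ballP.
  have K0 : 0 < `|K| + 1 by rewrite ltr_wpDl.
  exists (Num.min d (e / (`|K| + 1))) => /=; first by rewrite lt_min d0 divr_gt0.
  move=> z; rewrite /ball /= distrC lt_min => /andP[zd ze].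
  case: eqP => [_|/eqP zx]; first by rewrite subrr normr0.
  have zx' : z - x != 0 by rewrite subr_eq0.
  have -> : l - (phi z - phi x) / (z - x) = - ((phi z - phi x - l * (z - x)) / (z - x)).
    by field.
  rewrite normrN normrM normfV ltr_pdivrMr ?normr_gt0 //.
  apply: le_lt_trans (H _ zd) _.
  rewrite -real_normK ?num_real // expr2 mulrA ltr_pM2r ?normr_gt0 //.
  move: ze; rewrite ltr_pdivlMr // mulrC; apply: le_lt_trans.
  by rewrite ler_wpM2r // (le_trans (ler_norm _)) // lerDl.
- by rewrite eqxx.
Qed.

Lemma cderive_quad (R : realType) (f : R[i] -> R[i]) z l (K d : R) : 0 < d ->
  (forall h, normc h < d -> normc (f (z + h) - f z - l * h) <= K * normc h ^+ 2) ->
  cderive f z l.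
Proof.
move=> d0 H w; have w0 : 0 < normc w + 1 by rewrite ltr_wpDl ?normc_ge0.
have key (t : R) : `|t - 0| < d / (normc w + 1) ->
    normc (f (z + t%:C * w) - f (z + 0%:C * w) - l * w * t%:C) <= K * normc w ^+ 2 * (t - 0) ^+ 2.
  rewrite subr0 mul0r addr0 -mulrA [w * _]mulrC => ht.
  have hn : normc (t%:C * w) = `|t| * normc w by rewrite normcM normc_real.
  apply: le_trans (H _ _) _.
    rewrite hn; move: ht; rewrite ltr_pdivlMr //; apply: le_lt_trans.
    by rewrite ler_wpM2l // lerDl.
  by rewrite hn exprMn real_normK ?num_real // -mulrA [_ * t ^+ 2]mulrC.
split.
- apply: (@is_derive_quad _ _ _ (K * normc w ^+ 2) (d / (normc w + 1))); first exact: divr_gt0.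
  move=> t /key; apply: le_trans; apply: le_trans (Re_le_normc _).
  by rewrite !RecB [Re (l * w * _)]RecM /= mulr0 !subr0.
- apply: (@is_derive_quad _ _ _ (K * normc w ^+ 2) (d / (normc w + 1))); first exact: divr_gt0.
  move=> t /key; apply: le_trans; apply: le_trans (Im_le_normc _).
  by rewrite !ImcB [Im (l * w * _)]ImcM /= mulr0 add0r !subr0.
Qed.

Lemma cderive_near (R : realType) (f g : R[i] -> R[i]) z l (d : R) : 0 < d ->
  (forall u, normc (u - z) < d -> f u = g u) -> cderive f z l -> cderive g z l.
Proof.
move=> d0 fg Hf w; have w0 : 0 < normc w + 1 by rewrite ltr_wpDl ?normc_ge0.
have key : \forall t \near (0 : R), f (z + t%:C * w) = g (z + t%:C * w).
  apply/nbhs_ballP; exists (d / (normc w + 1)) => /=; first exact: divr_gt0.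
  move=> t; rewrite /ball /= sub0r normrN ltr_pdivlMr // => ht.
  apply: fg; rewrite addrAC subrr add0r normcM normc_real; apply: le_lt_trans ht.
  by rewrite ler_wpM2l // lerDl.
have [h1 h2] := Hf w.
by split; [apply: near_eq_is_derive h1|apply: near_eq_is_derive h2];
  near do congr (complex.Re _) || congr (complex.Im _); exact: key.
Unshelve. all: by end_near. Qed.

Lemma cderive_inv (R : realType) (z : R[i]) : z != 0 -> cderive (fun u => u^-1) z (- z ^- 2).
Proof.
move=> z0; have nz : 0 < normc z by rewrite normc_gt0.
apply: (@cderive_quad _ _ _ _ (2 / normc z ^+ 3) (normc z / 2)); first by rewrite divr_gt0.
move=> h hh; have zh : normc z / 2 <= normc (z + h).
  by have := ler_normcB z (- h); rewrite normcN opprK; lra.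
have zh0 : z + h != 0 by rewrite -normc_gt0; lra.
have -> : (z + h)^-1 - z^-1 - - z ^- 2 * h = h ^+ 2 / (z ^+ 2 * (z + h)).
  by field; rewrite z0 zh0.
rewrite normcM normcX normcV normcM normcX mulrC ler_wpM2r ?exprn_ge0 ?normc_ge0 //.
have -> : 2 / normc z ^+ 3 = (normc z ^+ 2 * (normc z / 2))^-1.
  by field; rewrite lt0r_neq0.
rewrite lef_pV2 ?posrE ?mulr_gt0 ?exprn_gt0 //; last lra.
by rewrite ler_wpM2l ?exprn_ge0 ?normc_ge0.
Qed.

Lemma MVT_01 (R : realType) (phi dphi : R -> R) (K : R) :
  (forall t : R, 0 <= t <= 1 -> is_derive t (1 : R) phi (dphi t)) ->
  (forall t : R, 0 <= t <= 1 -> `|dphi t| <= K) -> `|phi 1 - phi 0| <= K.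
Proof.
move=> Hd HK.
have [||c hc ->] := @MVT_segment R phi dphi 0 1 ler01.
- by move=> x; rewrite in_itv /= => /andP[h0 h1]; apply: Hd; rewrite !ltW.
- apply: derivable_within_continuous => x; rewrite in_itv /= => /Hd hd.
  exact: ex_derive.
- by rewrite subr0 mulr1; apply: HK; move: hc; rewrite in_itv.
Qed.

(** The real and imaginary parts have different mean value points, so they are estimated separately;
    this costs the factor [2]. *)
Lemma MVT_C (R : realType) (f g : R[i] -> R[i]) (a b : R[i]) (K : R) :
  (forall t : R, 0 <= t <= 1 -> cderive f (a + t%:C * (b - a)) (g (a + t%:C * (b - a)))) ->
  (forall t : R, 0 <= t <= 1 -> normc (g (a + t%:C * (b - a))) <= K) ->
  normc (f b - f a) <= 2 * K * normc (b - a).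
Proof.
set w := b - a => Hd HK.
have b1 : b = a + 1%:C * w by rewrite mul1r /w addrC subrK.
have a0 : a = a + 0%:C * w by rewrite mul0r addr0.
have bnd t : 0 <= t <= 1 -> normc (g (a + t%:C * w) * w) <= K * normc w.
  by move=> /HK h; rewrite normcM ler_wpM2r ?normc_ge0.
have key t : 0 <= t <= 1 -> path_derive (fun u : R => f (a + u%:C * w)) t (g (a + t%:C * w) * w).
  move=> /Hd /(_ w) [h1 h2].
  (* [cderive] differentiates at parameter [0] on the line through [a + t w]; a translation moves
     this to parameter [t] on the line through [a]. *)
  have sh (psi : R -> R) m : is_derive (0 : R) (1 : R) (fun u => psi (t + u)) m ->
      is_derive t (1 : R) psi m.
    move=> h; rewrite (_ : psi = (fun u => psi (t + u)) \o shift (- t)); last first.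
      by apply/funext => u /=; rewrite addrC subrK.
    rewrite -[m]mulr1; apply: is_derive1_comp; last exact: is_derive_shift.
    by rewrite /= subrr.
  have e u : a + t%:C * w + u%:C * w = a + (t + u)%:C * w.
    by rewrite rmorphD mulrDl addrA.
  split; apply: sh; [move: h1|move: h2];
    by under [X in is_derive _ _ X _ -> _]eq_fun do rewrite e.
apply: le_trans (normc_le_ReIm _) _; rewrite -mulrA mulr_natl mulr2n RecB ImcB; apply: lerD.
- rewrite [in Re (f b)]b1 [in Re (f a)]a0.
  apply: (@MVT_01 _ (fun t => Re (f (a + t%:C * w))) (fun t => Re (g (a + t%:C * w) * w))).
    by move=> t /key [].
  by move=> t /bnd; apply: le_trans; apply: Re_le_normc.
- rewrite [in Im (f b)]b1 [in Im (f a)]a0.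
  apply: (@MVT_01 _ (fun t => Im (f (a + t%:C * w))) (fun t => Im (g (a + t%:C * w) * w))).
    by move=> t /key [].
  by move=> t /bnd; apply: le_trans; apply: Im_le_normc.
Qed.

(** * Derivatives of power series; the exponential *)

(** The natural bound for the exponent [n = j+1] is [n^2 K^(n-2) |h|^2]; the factor [K ^+ 2] on the
    left avoids the exponent [n-2]. The induction step uses [n^2 + n <= (n+1)^2]. *)
Lemma pow_taylor (R : realType) (z h : R[i]) (K : R) j :
  normc z + normc h <= K ->
  K ^+ 2 * normc ((z + h) ^+ j.+1 - z ^+ j.+1 - j.+1%:R * z ^+ j * h)
    <= j.+1%:R ^+ 2 * K ^+ j.+1 * normc h ^+ 2.
Proof.
move=> hK; have zK : normc z <= K by have := normc_ge0 h; lra.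
have zhK : normc (z + h) <= K by apply: le_trans (le_normcD _ _) hK.
have K0 : 0 <= K by apply: le_trans zK; apply: normc_ge0.
have h0 := normc_ge0 h.
elim: j => [|j IH].
  rewrite !expr1 expr0 !mulr1 mul1r (_ : z + h - z - h = 0); last by ring.
  by rewrite normc0 mulr0 !mulr_ge0 ?exprn_ge0.
have -> : (z + h) ^+ j.+2 - z ^+ j.+2 - j.+2%:R * z ^+ j.+1 * h =
  (z + h) * ((z + h) ^+ j.+1 - z ^+ j.+1 - j.+1%:R * z ^+ j * h) + j.+1%:R * z ^+ j * h ^+ 2.
  rewrite -[j.+2%:R]natr1 [(z + h) ^+ j.+2]exprS [z ^+ j.+2]exprS [z ^+ j.+1]exprS; ring.
apply: le_trans (ler_wpM2l (exprn_ge0 _ K0) (le_normcD _ _)) _.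
rewrite mulrDr normcM mulrCA !normcM normc_nat !normcX.
apply: (@le_trans _ _ (K * (j.+1%:R ^+ 2 * K ^+ j.+1 * normc h ^+ 2) +
   K ^+ 2 * (j.+1%:R * K ^+ j * normc h ^+ 2))).
  apply: lerD; first by apply: ler_pM; rewrite ?normc_ge0 ?mulr_ge0 ?exprn_ge0 ?normc_ge0.
  rewrite -expr2 ler_wpM2l ?exprn_ge0 // ler_wpM2r ?exprn_ge0 // ler_wpM2l //.
  by rewrite lerXn2r ?nnegrE ?normc_ge0.
have -> : K * (j.+1%:R ^+ 2 * K ^+ j.+1 * normc h ^+ 2) +
   K ^+ 2 * (j.+1%:R * K ^+ j * normc h ^+ 2) =
   (j.+1%:R ^+ 2 + j.+1%:R) * (K ^+ j.+2 * normc h ^+ 2).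
  by rewrite [K ^+ j.+2]exprS [K ^+ j.+1]exprS; ring.
rewrite -[leRHS]mulrA; apply: ler_wpM2r; first by rewrite mulr_ge0 ?exprn_ge0.
rewrite -[j.+2%:R]natr1; have : 0 <= (j.+1%:R : R) by [].
by set x := j.+1%:R; nra.
Qed.

Definition pder (R : realType) (c : nat -> R[i]) (j : nat) : R[i] := j.+1%:R * c j.+1.

Lemma geo_bounded_pder (R : realType) (B : R) c : geo_bounded B c -> geo_bounded (2 * B ^+ 2) (pder c).
Proof.
move=> [B1 Hc]; split; first by have := exprn_ege1 2 B1; lra.
move=> j; rewrite normcM normc_nat exprMn -exprM; apply: ler_pM; rewrite ?normc_ge0 //.
  by rewrite -natrX ler_nat ltnW // ltn_expl.
by apply: le_trans (Hc _) _; rewrite ler_weXn2l //; lia.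
Qed.

Lemma is_psval_cvg (R : realType) (c : nat -> R[i]) z S : is_psval c z S -> cvgC (pspart c z) S.
Proof. by move=> [K HK]; apply: geo_cvgC half_ge0 half_lt1 HK. Qed.

Lemma cvgC_shift (R : realType) (u : nat -> R[i]) a : cvgC u a -> cvgC (fun n => u n.+1) a.
Proof.
move=> H e e0; have [N HN] := H e e0; exists N => n Nn; apply: HN; exact: leqW.
Qed.

(** The quadratic estimate is proved for partial sums with a constant independent of [m], then
    passed to the limit. Cutting [c] at [m.+1] terms and [pder c] at [m] terms makes them match as
    polynomial and derivative. *)
Lemma cderive_psval (R : realType) (B : R) c z : geo_bounded B c ->
  normc z < (8 * (2 * B ^+ 2))^-1 / 2 -> cderive (psval c) z (psval (pder c) z).
Proof.
move=> gc hz; have gd := geo_bounded_pder gc; have [B1 Hc] := gc.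
set r := (8 * (2 * B ^+ 2))^-1 in hz.
have B2 : B <= 2 * B ^+ 2 by rewrite expr2; nra.
have r0 : 0 < r by rewrite invr_gt0; lra.
have rB : r <= (8 * B)^-1 by rewrite lef_pV2 ?posrE; lra.
(* [K] is the radius for [c], and [r] the smaller one for [pder c]; halving [r] for both [z] and [h]
   keeps [z + h] inside. *)
set K := (8 * B)^-1 in rB; have K0 : 0 < K by rewrite invr_gt0; lra.
apply: (@cderive_quad _ _ _ _ (2 * B / K ^+ 2) (r / 2)); first by rewrite divr_gt0.
move=> h hh; have zhr : normc (z + h) <= r by apply: le_trans (le_normcD _ _) _; lra.
have s1 : is_psval c (z + h) (psval c (z + h)) by apply: psval_spec gc _; rewrite -/K; lra.
have s2 : is_psval c z (psval c z) by apply: psval_spec gc _; rewrite -/K; lra.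
have s3 : is_psval (pder c) z (psval (pder c) z) by apply: psval_spec gd _; rewrite -/r; lra.
have cv := cvgC_add (cvgC_add (cvgC_shift (is_psval_cvg s1)) (cvgC_scale (-1) (cvgC_shift (is_psval_cvg s2))))
   (cvgC_scale (- h) (is_psval_cvg s3)).
have -> : psval c (z + h) - psval c z - psval (pder c) z * h =
   (psval c (z + h) + -1 * psval c z + - h * psval (pder c) z) - 0 by ring.
apply: cvgC_le cv _ => m; rewrite subr0.
have -> : pspart c (z + h) m.+1 + -1 * pspart c z m.+1 + - h * pspart (pder c) z m =
   \sum_(j < m) c j.+1 * ((z + h) ^+ j.+1 - z ^+ j.+1 - j.+1%:R * z ^+ j * h).
  rewrite /pspart !big_ord_recl /= !expr0 mulN1r mulNr mulr_sumr.
  rewrite opprD addrACA subrr add0r -!sumrB; apply: eq_bigr => j _.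
  rewrite /pder /bump /= add1n; ring.
apply: le_trans (normc_sum _) _.
apply: (@le_trans _ _ (\sum_(j < m) (2 * B / K ^+ 2 * normc h ^+ 2) * 2^-1 ^+ j.+1)); last first.
  rewrite -mulr_sumr ler_piMr ?sum_half_le // !mulr_ge0 ?exprn_ge0 ?normc_ge0 ?invr_ge0 ?exprn_ge0 //; lra.
apply: ler_sum => j _; rewrite normcM.
have hK : normc z + normc h <= K by lra.
have := pow_taylor j hK; set X := normc (_ - _ - _) => HX.
rewrite -(ler_pM2l (exprn_gt0 2 K0)) mulrCA.
apply: le_trans (ler_wpM2l (normc_ge0 _) HX) _.
have -> : K ^+ 2 * (2 * B / K ^+ 2 * normc h ^+ 2 * 2^-1 ^+ j.+1) = 2 * B * 2^-1 ^+ j.+1 * normc h ^+ 2.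
  by field; rewrite lt0r_neq0.
rewrite mulrA ler_wpM2r ?exprn_ge0 ?normc_ge0 //.
have cK : normc (c j.+1) * K ^+ j.+1 <= B * 8^-1 ^+ j.+1.
  have := @geo_bounded_term _ B c K%:C j.+1 gc; rewrite normcM normcX normc_real gtr0_norm //; exact.
have -> : normc (c j.+1) * (j.+1%:R ^+ 2 * K ^+ j.+1) = j.+1%:R ^+ 2 * (normc (c j.+1) * K ^+ j.+1) by ring.
have e1 : j.+1%:R <= (2 : R) ^+ j.+1 by rewrite -natrX ler_nat ltnW // ltn_expl.
apply: (@le_trans _ _ (((2 : R) ^+ j.+1) ^+ 2 * (B * 8^-1 ^+ j.+1))).
  apply: ler_pM; rewrite ?exprn_ge0 ?mulr_ge0 ?normc_ge0 ?exprn_ge0 //; first exact: ltW.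
  by rewrite lerXn2r ?nnegrE ?exprn_ge0.
have -> : ((2 : R) ^+ j.+1) ^+ 2 * (B * 8^-1 ^+ j.+1) = B * 2^-1 ^+ j.+1.
  rewrite mulrCA -exprM mulnC exprM -exprMn; by congr (_ * _ ^+ _); field.
by apply: ler_wpM2r; rewrite ?exprn_ge0 ?invr_ge0 //; lra.
Qed.

Lemma analytic0_deriv (R : realType) (f : R[i] -> R[i]) : analytic0 f ->
  exists2 g, analytic0 g & exists2 rho : R, 0 < rho &
    forall z, normc z < rho -> cderive f z (g z).
Proof.
move=> [B [c [gc H]]]; have [B1 _] := gc.
exists (psval (pder c)); first exact: analytic0_psval (geo_bounded_pder gc).
have B2 : B <= 2 * B ^+ 2 by rewrite expr2; nra.
have r0 : 0 < (8 * (2 * B ^+ 2))^-1 / 2 by rewrite divr_gt0 // invr_gt0; lra.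
exists ((8 * (2 * B ^+ 2))^-1 / 2) => // z hz.
apply: cderive_near r0 _ (cderive_psval gc hz) => u hu; rewrite H //.
apply: (rad_mono B1 B2); have := normc_split u z 0; rewrite !subr0; lra.
Qed.

Lemma analytic0_prim (R : realType) (f : R[i] -> R[i]) : analytic0 f ->
  exists2 F, analytic0 F & exists2 rho : R, 0 < rho &
    forall z, normc z < rho -> cderive F z (f z).
Proof.
move=> [B [c [gc H]]]; have [B1 Hc] := gc.
pose d j := if j is j'.+1 then c j' / j'.+1%:R else 0 : R[i].
have gd : geo_bounded B d.
  split=> // [[|j]] /=; first by rewrite normc0 exprn_ge0 //; lra.
  rewrite normcM normcV normc_nat; apply: (@le_trans _ _ (normc (c j))).
    by rewrite ler_piMr ?normc_ge0 // invf_le1 // ler1n.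
  by apply: le_trans (Hc j) _; rewrite ler_weXn2l.
exists (psval d); first exact: analytic0_psval gd.
have B2 : B <= 2 * B ^+ 2 by rewrite expr2; nra.
have r0 : 0 < (8 * (2 * B ^+ 2))^-1 by rewrite invr_gt0; lra.
exists ((8 * (2 * B ^+ 2))^-1 / 2) => [|z hz]; first by rewrite divr_gt0.
rewrite H; last by apply: (rad_mono B1 B2); lra.
have -> : c = pder d.
  apply/funext => j; rewrite /pder /d mulrC divfK // pnatr_eq0 //.
exact: cderive_psval gd hz.
Qed.

Lemma cexpD (R : realType) (z w : R[i]) : cexp (z + w) = cexp z * cexp w.
Proof.
case: z w => a b [c d]; rewrite /cexp /= expRD sinD cosD.
apply/eqP; rewrite eq_complex /=; apply/andP; split; apply/eqP; ring.
Qed.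

Lemma cexp0 (R : realType) : cexp (0 : R[i]) = 1.
Proof. by rewrite /cexp /= expR0 cos0 sin0 mul1r. Qed.

Lemma normc_cexp (R : realType) (z : R[i]) : normc (cexp z) = expR (Re z).
Proof.
rewrite /cexp normcM normc_real gtr0_norm ?expR_gt0 //.
by rewrite /normc cos2Dsin2 sqrtr1 mulr1.
Qed.

Lemma cexp_nat (R : realType) (z : R[i]) n : cexp (n%:R * z) = cexp z ^+ n.
Proof.
elim: n => [|n IH]; first by rewrite mul0r cexp0 expr0.
by rewrite -natr1 mulrDl mul1r cexpD IH exprSr.
Qed.

Lemma cderive_cexp (R : realType) (z : R[i]) : cderive (@cexp R) z (cexp z).
Proof.
move=> w; have [h1 h2] := path_derive_line z w 0.
have hE := is_derive1_comp (is_derive_expR _) h1.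
have hc := is_derive1_comp (is_derive_cos _) h2.
have hs := is_derive1_comp (is_derive_sin _) h2.
split.
- rewrite (_ : (fun u => _) = (@expR R \o (fun t : R => Re (z + t%:C * w))) *
       (@cos R \o (fun t : R => Im (z + t%:C * w)))).
    apply: is_derive_eq; rewrite /GRing.scale /= mul0r addr0 /cexp RecM RecM ImcM /=; ring.
  by apply/funext => u; rewrite /cexp RecM /= mul0r subr0.
- rewrite (_ : (fun u => _) = (@expR R \o (fun t : R => Re (z + t%:C * w))) *
       (@sin R \o (fun t : R => Im (z + t%:C * w)))).
    apply: is_derive_eq; rewrite /GRing.scale /= mul0r addr0 /cexp ImcM RecM ImcM /=; ring.
  by apply/funext => u; rewrite /cexp ImcM /= mul0r addr0.
Qed.

Definition cexp_coef (R : realType) (j : nat) : R[i] := (j`!%:R)^-1.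

Lemma cderive_pspart (R : realType) (c : nat -> R[i]) z m : cderive (fun u => pspart c u m.+1) z (pspart (pder c) z m).
Proof.
rewrite (_ : (fun u => _) = fun u => c 0%N + \sum_(j < m) c j.+1 * u ^+ j.+1).
  rewrite /pspart -[X in cderive _ _ X]add0r; apply: cderive_add (cderive_cst _ _) _; apply: cderive_sum => j.
  by apply: cderive_eq (cderive_scale _ (cderive_X _ (cderive_id _))) _; rewrite /pder; ring.
by apply/funext => u; rewrite /pspart big_ord_recl expr0 mulr1.
Qed.

(** The derivative of a Taylor remainder is the remainder of the previous order, so each step of the
    induction is one use of [MVT_C], whose factor [2] appears in [2 * normc z]. Dropping the
    factorial still leaves rate [1/4] for [normc z <= 1/8]. *)
Lemma cexp_taylor (R : realType) m (z : R[i]) : normc z <= 1 ->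
  normc (cexp z - pspart (cexp_coef R) z m) <= expR 1 * (2 * normc z) ^+ m.
Proof.
have pd_coef : pder (cexp_coef R) = cexp_coef R.
  apply/funext => j; rewrite /pder /cexp_coef factS natrM invfM mulrA divff ?mul1r //.
elim: m z => [|m IH] z hz.
  rewrite /pspart big_ord0 subr0 expr0 mulr1 normc_cexp ler_expR.
  by apply: le_trans hz; apply: le_trans (Re_le_normc z); apply: ler_norm.
have hn t : 0 <= t <= 1 -> normc (0 + t%:C * (z - 0)) <= normc z.
  move=> /andP[t0 t1]; rewrite add0r subr0 normcM normc_real ger0_norm //.
  by rewrite ler_piMl ?normc_ge0.
have H := @MVT_C R (fun u => cexp u - pspart (cexp_coef R) u m.+1)
  (fun u => cexp u - pspart (cexp_coef R) u m) 0 z (expR 1 * (2 * normc z) ^+ m).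
have e0 : cexp_coef R 0 = 1 by rewrite /cexp_coef fact0 invr1.
move: H; rewrite cexp0 pspart0 e0 subrr !subr0.
have -> : 2 * (expR 1 * (2 * normc z) ^+ m) * normc z = expR 1 * (2 * normc z) ^+ m.+1.
  by rewrite exprS; ring.
apply.
- move=> t _; apply: cderive_sub (cderive_cexp _) _; by have := cderive_pspart (cexp_coef R) (0 + t%:C * z) m; rewrite pd_coef.
- move=> t /hn ht; have ht1 := le_trans ht hz.
  rewrite subr0 in ht ht1.
  apply: le_trans (IH _ ht1) _; rewrite ler_wpM2l ?expR_ge0 //.
  by rewrite lerXn2r ?nnegrE ?mulr_ge0 ?normc_ge0 // ler_wpM2l.
Qed.

Lemma analytic0_cexp (R : realType) : analytic0 (@cexp R).
Proof.
exists 1, (cexp_coef R); split.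
  split=> // j; rewrite expr1n /cexp_coef normcV normc_nat invf_le1 ?ler1n ?ltr0n fact_gt0 //.
move=> z; rewrite mulr1 => hz; apply/esym/psval_eq; exists (expR 1) => m.
rewrite normcB; apply: le_trans (cexp_taylor m _) _.
  by apply: le_trans hz _; rewrite invf_le1 // ler1n.
rewrite ler_wpM2l ?expR_ge0 // lerXn2r ?nnegrE ?mulr_ge0 ?normc_ge0 ?invr_ge0 //; lra.
Qed.

(** * Laurent germs and their logarithmic extension *)

Definition laurent (R : realType) (f : R[i] -> R[i]) := exists (N : nat) g, analytic0 g /\
  exists2 rho : R, 0 < rho & forall z, z != 0 -> normc z < rho -> f z = g z / z ^+ N.

Lemma laurent_near (R : realType) (f g : R[i] -> R[i]) (rho : R) : 0 < rho -> laurent f ->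
  (forall z, z != 0 -> normc z < rho -> g z = f z) -> laurent g.
Proof.
move=> r0 [N [h [ah [r1 r10 H]]]] fg; exists N, h; split=> //.
exists (Num.min rho r1); first by rewrite lt_min r0.
by move=> z z0; rewrite lt_min => /andP[h1 h2]; rewrite fg // H.
Qed.

Lemma laurent_ang (R : realType) (f : R[i] -> R[i]) : analytic0 f -> laurent f.
Proof. by move=> af; exists 0%N, f; split=> //; exists 1 => // z _ _; rewrite expr0 divr1. Qed.

Lemma laurent_cst (R : realType) (a : R[i]) : laurent (fun=> a).
Proof. exact: laurent_ang (analytic0_cst a). Qed.

Lemma laurent_mul (R : realType) (f g : R[i] -> R[i]) : laurent f -> laurent g ->
  laurent (fun z => f z * g z).
Proof.
move=> [N [f' [af [r r0 Hf]]]] [M [g' [ag [s s0 Hg]]]].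
exists (N + M)%N, (fun z => f' z * g' z); split; first exact: analytic0_mul.
exists (Num.min r s); first by rewrite lt_min r0.
move=> z z0; rewrite lt_min => /andP[h1 h2].
by rewrite Hf // Hg // exprD invfM mulrACA.
Qed.

Lemma laurent_add (R : realType) (f g : R[i] -> R[i]) : laurent f -> laurent g ->
  laurent (fun z => f z + g z).
Proof.
move=> [N [f' [af [r r0 Hf]]]] [M [g' [ag [s s0 Hg]]]].
exists (N + M)%N, (fun z => f' z * z ^+ M + g' z * z ^+ N); split.
  by apply: analytic0_add; apply: analytic0_mul => //; apply: analytic0_X; apply: analytic0_id.
exists (Num.min r s); first by rewrite lt_min r0.
move=> z z0; rewrite lt_min => /andP[h1 h2].
rewrite Hf // Hg // exprD; field; by rewrite !expf_neq0.
Qed.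

Lemma laurent_scale (R : realType) (f : R[i] -> R[i]) a : laurent f -> laurent (fun z => a * f z).
Proof. by apply: laurent_mul; apply: laurent_cst. Qed.

Lemma laurent_inv_id (R : realType) : laurent (fun z : R[i] => z^-1).
Proof.
exists 1%N, (fun=> 1); split; first exact: analytic0_cst.
by exists 1 => // z _ _; rewrite expr1 mul1r.
Qed.

Lemma cderive_uniq (R : realType) (f : R[i] -> R[i]) z l m : cderive f z l -> cderive f z m -> l = m.
Proof.
move=> /(_ 1) [h1 h2] /(_ 1) [k1 k2]; rewrite !mulr1 in h1 h2 k1 k2.
have e1 : Re l = Re m.
  by rewrite -(@derive_val _ _ _ _ _ _ _ h1) (@derive_val _ _ _ _ _ _ _ k1).
have e2 : Im l = Im m.
  by rewrite -(@derive_val _ _ _ _ _ _ _ h2) (@derive_val _ _ _ _ _ _ _ k2).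
by case: l m e1 e2 {h1 h2 k1 k2} => a b [c d] /= -> ->.
Qed.

(** Write [e^(rz) - 1 = z g(z)]. Comparing the derivatives of both sides at [0] gives [g(0) = r],
    which is nonzero, so [g] is invertible. *)
Lemma laurent_geom (R : realType) (r : nat) : (0 < r)%N ->
  laurent (fun z : R[i] => (cexp (r%:R * z) - 1)^-1).
Proof.
case: r => // r _.
have ae : analytic0 (fun z : R[i] => cexp z ^+ r.+1 + -1).
  by apply: analytic0_add (analytic0_cst _); apply: analytic0_X; apply: analytic0_cexp.
have [g ag [rho r0 H]] := analytic0_shift ae.
have H' z : normc z < rho -> cexp z ^+ r.+1 + -1 = z * g z.
  by move=> /H ->; rewrite cexp0 expr1n subrr add0r.
have g0 : g 0 != 0.
  have [g' _ [s s0 /(_ 0)]] := analytic0_deriv ag; rewrite normc0 => /(_ s0) Dg.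
  have d1 := cderive_mul (cderive_id 0) Dg; rewrite mul0r addr0 mul1r in d1.
  have d2 := cderive_add (cderive_X r (cderive_cexp (0 : R[i]))) (cderive_cst (-1) 0).
  have d3 : cderive (fun u => u * g u) 0 (r.+1%:R * cexp 0 ^+ r * cexp 0 + 0).
    by apply: cderive_near r0 _ d2 => u; rewrite subr0; apply: H'.
  by rewrite (cderive_uniq d1 d3) cexp0 expr1n !mulr1 addr0 pnatr_eq0.
have [k ak [s s0 Hk]] := analytic0_inv ag g0.
apply: (@laurent_near _ (fun z => z^-1 * k z) _ (Num.min rho s)).
- by rewrite lt_min r0.
- by apply: laurent_mul (laurent_inv_id R) (laurent_ang ak).
- move=> z z0; rewrite lt_min => /andP[h1 h2].
  rewrite cexp_nat H' // invfM; congr (_ * _).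
  have gk := Hk z h2; apply: (mulfI (x := g z)).
    by apply/eqP => gz; move: gk; rewrite gz mul0r => /esym/eqP; rewrite oner_eq0.
  rewrite gk divff //; apply/eqP => gz; move: gk; rewrite gz mul0r => /esym/eqP.
  by rewrite oner_eq0.
Qed.

Lemma laurent_conv (R : realType) (f : R[i] -> R[i]) : laurent f -> is_conv_laurent f.
Proof.
move=> [N [g [[B [c [gc Hc]]] [rho r0 H]]]]; have [B1 _] := gc.
have rB0 : 0 < (8 * B)^-1 by rewrite invr_gt0; lra.
exists N, c, (Num.min rho (8 * B)^-1); split; first by rewrite lt_min r0.
move=> z; rewrite normr_gt0 normcE_norm ltcR lt_min => z0 /andP[h1 /ltW h2].
rewrite H // Hc // mulrC.
apply: eq_cvgC (cvgC_scale _ (is_psval_cvg (psval_spec gc h2))) => m.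
rewrite /pspart mulr_sumr; apply: eq_bigr => j _.
rewrite expfzDr //.
rewrite -(exprnP z j) -exprnN; ring.
Qed.

(** [c] is the residue: [1/z] has no Laurent primitive. Induction on the order of the pole peels off
    [g 0 / z^(N+1)], which has an elementary primitive unless [N = 0]. *)
Lemma laurent_prim (R : realType) (f : R[i] -> R[i]) : laurent f ->
  exists A c, laurent A /\ exists2 rho : R, 0 < rho &
   forall z, z != 0 -> normc z < rho -> cderive A z (f z - c / z).
Proof.
move=> [N [g [ag [rho r0 H]]]].
suff [A [c [lA [s s0 HA]]]] : exists A c, laurent A /\ exists2 rho : R, 0 < rho &
   forall z, z != 0 -> normc z < rho -> cderive A z (g z / z ^+ N - c / z).
  exists A, c; split=> //; exists (Num.min rho s); first by rewrite lt_min r0.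
  by move=> z z0; rewrite lt_min => /andP[h1 h2]; rewrite H //; apply: HA.
elim: N g ag {f rho r0 H} => [|N IH] g ag.
  have [F aF [s s0 HF]] := analytic0_prim ag; exists F, 0; split; first exact: laurent_ang.
  by exists s => // z z0 /HF; rewrite expr0 divr1 mul0r subr0.
have [h ah [r r0 Hg]] := analytic0_shift ag.
have [A [c [lA [s s0 HA]]]] := IH h ah.
have e z : z != 0 -> normc z < r -> g z / z ^+ N.+1 = g 0 / z ^+ N.+1 + h z / z ^+ N.
  by move=> z0 /Hg ->; rewrite mulrDl exprS; congr (_ + _); field; rewrite z0 expf_neq0.
(* For a simple pole the peeled term joins the residue. *)
case: N IH HA e => [|N] IH HA e.
  exists A, (c + g 0); split=> //; exists (Num.min r s); first by rewrite lt_min r0.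
  move=> z z0; rewrite lt_min => /andP[h1 h2].
  by apply: cderive_eq (HA z z0 h2) _; rewrite e // expr1 mulrDl; ring.
exists (fun z => A z + (- g 0 / N.+1%:R) * (z^-1) ^+ N.+1), c; split.
  apply: laurent_add => //; apply: laurent_scale; elim: N.+1 => [|n IHn].
    by rewrite (_ : (fun _ => _) = fun=> 1); [apply: laurent_cst|apply/funext].
  rewrite (_ : (fun _ => _) = fun z => z^-1 * z^-1 ^+ n); first exact: laurent_mul (laurent_inv_id R) _.
  by apply/funext => z; rewrite exprS.
exists (Num.min r s); first by rewrite lt_min r0.
move=> z z0; rewrite lt_min => /andP[h1 h2].
apply: cderive_eq (cderive_add (HA z z0 h2) (cderive_scale _ (cderive_X _ (cderive_inv z0)))) _.
rewrite e // exprVn !exprS; field.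
by rewrite z0 expf_neq0 //= pnatr_eq0.
Qed.

(** The derivative of [atan (y / x)] along a path with velocity [a + ib], rewritten as the imaginary
    part of [(a + ib) / (x + iy)]. *)
Lemma atan_aux (F : fieldType) (x y a b : F) : x != 0 -> x ^+ 2 + y ^+ 2 != 0 ->
  (1 + (y / x) ^+ 2)^-1 * (y * (- x ^- 2 * a) + x^-1 * b) =
  x / (x ^+ 2 + y ^+ 2) * b + - (y / (x ^+ 2 + y ^+ 2)) * a.
Proof.
move=> x0 s0; have -> : 1 + (y / x) ^+ 2 = (x ^+ 2 + y ^+ 2) / x ^+ 2 by field.
by field; rewrite s0 x0.
Qed.

(** On this half-plane, which contains [- eps] whenever [Re eps < 0], [carg] is the single branch
    [atan (y / x)]; the cut never matters. *)
Lemma cderive_clog (R : realType) (u : R[i]) : 0 < Re u -> cderive (@clog R) u u^-1.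
Proof.
move=> u0.
apply: (@cderive_near _ (fun v => (ln (Num.sqrt (Re v ^+ 2 + Im v ^+ 2))) +i* (atan (Im v / Re v))) _ _ _ (Re u)) => //.
  move=> v hv; rewrite /clog /carg ifT //.
  have := Re_le_normc (v - u); rewrite RecB ler_norml => /andP[h1 h2]; lra.
move=> w; have [h1 h2] := path_derive_line u w 0.
set x := (fun t : R => Re (u + t%:C * w)) in h1.
set y := (fun t : R => Im (u + t%:C * w)) in h2.
have x0 : x 0 = Re u by rewrite /x mul0r addr0.
have y0 : y 0 = Im u by rewrite /y mul0r addr0.
have hs : is_derive (0 : R) (1 : R) (x * x + y * y) (2 * (x 0 * Re w + y 0 * Im w)).
  by apply: is_derive_eq; rewrite /GRing.scale /=; ring.
have s0 : 0 < (x * x + y * y) 0.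
  by rewrite /GRing.add /= /GRing.mul /= x0; have := sqr_ge0 (y 0); rewrite expr2; nra.
have q0 : 0 < Num.sqrt ((x * x + y * y) 0) by rewrite sqrtr_gt0.
have hq := is_derive1_comp (is_derive1_sqrt s0) hs.
have hl := @is_derive1_comp _ (@ln R) (@Num.sqrt R \o (x * x + y * y)) 0 _ _ (is_derive1_ln q0) hq.
have xn0 : x 0 != 0 by rewrite x0 lt0r_neq0.
have hv := is_deriveV xn0 h1.
have hd := is_deriveM h2 hv.
have ha := @is_derive1_comp _ (@atan R) (y * (fun t => (x t)^-1)) 0 _ _ (is_derive1_atan _) hd.
have q2 : Num.sqrt ((x * x + y * y) 0) ^+ 2 = x 0 ^+ 2 + y 0 ^+ 2.
  by rewrite sqr_sqrtr ?ltW.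
have S0 : x 0 ^+ 2 + y 0 ^+ 2 != 0 by rewrite -q2 expf_neq0 // lt0r_neq0.
have eRe : Re u^-1 = x 0 / (x 0 ^+ 2 + y 0 ^+ 2) by rewrite x0 y0; case: (u).
have eIm : Im u^-1 = - (y 0 / (x 0 ^+ 2 + y 0 ^+ 2)) by rewrite x0 y0; case: (u).
split.
- rewrite (_ : (fun t => _) = @ln R \o (@Num.sqrt R \o (x * x + y * y))); last first.
    by apply/funext => t /=; rewrite !expr2.
  apply: is_derive_eq hl _; rewrite RecM eRe eIm -q2; set q := Num.sqrt _ in q0 *.
  by field; rewrite lt0r_neq0.
- rewrite (_ : (fun t => _) = @atan R \o (y * (fun t => (x t)^-1))); last by apply/funext.
  apply: is_derive_eq ha _; rewrite ImcM eRe eIm /GRing.scale /=.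
  rewrite (_ : (y * (fun t => (x t)^-1)) 0 = y 0 / x 0) //.
  exact: atan_aux.
Qed.

Definition logN (R : realType) (z : R[i]) : R[i] := clog (- z).

Lemma cderive_logN (R : realType) (z : R[i]) : Re z < 0 -> cderive (@logN R) z z^-1.
Proof.
move=> z0; have h : 0 < Re (-1 * z) by rewrite RecM /= oppr0 mul0r subr0; lra.
have := cderive_linear_comp (cderive_clog h); rewrite mulN1r invrN mulrN mulNr mul1r opprK.
by rewrite (_ : (fun u => _) = @logN R) //; apply/funext => u; rewrite mulN1r.
Qed.

(** Terms come in any order and exponents may repeat, which makes the closure properties plain
    inductions; [laurent_log_final] collects equal powers. *)
Inductive laurent_log (R : realType) : (R[i] -> R[i]) -> Prop :=
| laurent_log_nil : laurent_log (fun=> 0)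
| laurent_log_cons a n f : laurent a -> laurent_log f -> laurent_log (fun z => a z * logN z ^+ n + f z).

Lemma laurent_log_add (R : realType) (f g : R[i] -> R[i]) : laurent_log f -> laurent_log g -> laurent_log (fun z => f z + g z).
Proof.
move=> Lf hg; elim: Lf => [|a n f' la _ IH].
  by rewrite (_ : (fun z => _) = g) //; apply/funext => z; rewrite add0r.
rewrite (_ : (fun z => _) = fun z => a z * logN z ^+ n + (f' z + g z)); first exact: laurent_log_cons.
by apply/funext => z; rewrite addrA.
Qed.

Lemma laurent_log_lau (R : realType) (b f : R[i] -> R[i]) : laurent b -> laurent_log f -> laurent_log (fun z => b z * f z).
Proof.
move=> lb Lf; elim: Lf => [|a n f' la _ IH].
  by rewrite (_ : (fun z => _) = fun=> 0); [apply: laurent_log_nil|apply/funext => z; rewrite mulr0].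
rewrite (_ : (fun z => _) = fun z => (b z * a z) * logN z ^+ n + b z * f' z).
  by apply: laurent_log_cons IH; apply: laurent_mul.
by apply/funext => z; rewrite mulrDr mulrA.
Qed.

Lemma laurent_log_term (R : realType) (a : R[i] -> R[i]) n : laurent a -> laurent_log (fun z => a z * logN z ^+ n).
Proof.
move=> la; rewrite (_ : (fun z => _) = fun z => a z * logN z ^+ n + 0).
  by apply: laurent_log_cons => //; apply: laurent_log_nil.
by apply/funext => z; rewrite addr0.
Qed.

Lemma laurent_log_of_lau (R : realType) (a : R[i] -> R[i]) : laurent a -> laurent_log a.
Proof.
move=> /(laurent_log_term 0); rewrite (_ : (fun z => _) = a) //.
by apply/funext => z; rewrite expr0 mulr1.
Qed.

(** Allowing every [M' >= M] lets the induction pass to a common bound when a new exponent exceeds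
    the old one. *)
Lemma laurent_log_final (R : realType) (f : R[i] -> R[i]) : laurent_log f ->
  exists M (a : nat -> R[i] -> R[i]), (forall n, laurent (a n)) /\
   forall M', (M <= M')%N -> forall z, f z = \sum_(n < M'.+1) a n z * clog (- z) ^+ n.
Proof.
elim=> [|b n g lb _ [M [a [la H]]]].
  exists 0%N, (fun _ _ => 0); split=> [n|M' _ z]; first exact: laurent_cst.
  by rewrite big1 // => i _; rewrite mul0r.
exists (maxn M n), (fun m z => (if m == n then 1 else 0) * b z + a m z); split.
  by move=> m; apply: laurent_add => //; apply: laurent_scale.
move=> M'; rewrite geq_max => /andP[h1 h2] z.
under eq_bigr do rewrite mulrDl; rewrite big_split /= -H //; congr (_ + _).
have hn : (n < M'.+1)%N by [].
rewrite (bigD1 (Ordinal hn)) //= eqxx mul1r big1 ?addr0 // => i hi.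
by rewrite ifN ?mul0r // ; apply: contra hi => /eqP e; apply/eqP/val_inj.
Qed.

Definition has_prim (R : realType) (f : R[i] -> R[i]) :=
  exists2 H, laurent_log H & exists2 rho : R, 0 < rho &
    forall z, Re z < 0 -> normc z < rho -> cderive H z (f z).

Lemma Re_lt0_neq0 (R : realType) (z : R[i]) : Re z < 0 -> z != 0.
Proof. by apply: contraTneq => ->; rewrite ltxx. Qed.

(** Integration by parts. If [A' = a - c / z] and [L] is the logarithm, then
    [A L^(n+1) + c / (n+2) L^(n+2)] has derivative [a L^(n+1) + (n+1) (A / z) L^n], whose last term
    has a lower power of [L]. *)
Lemma has_prim_term (R : realType) n (a : R[i] -> R[i]) : laurent a ->
  has_prim (fun z => a z * logN z ^+ n).
Proof.
elim: n a => [|n IH] a la; have [A [c [lA [r r0 HA]]]] := laurent_prim la.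
  exists (fun z => A z + c * logN z).
    apply: laurent_log_add; first exact: laurent_log_of_lau.
    by have := laurent_log_term 1 (laurent_cst c).
  exists r => // z z0 hz; have zn := Re_lt0_neq0 z0.
  apply: cderive_eq (cderive_add (HA z zn hz) (cderive_scale c (cderive_logN z0))) _.
  by rewrite expr0 mulr1 subrK.
have [H LH [s s0 HH]] := IH _ (laurent_scale (- n.+1%:R) (laurent_mul lA (laurent_inv_id R))).
exists (fun z => A z * logN z ^+ n.+1 + c / n.+2%:R * logN z ^+ n.+2 + H z).
  apply: laurent_log_add LH; apply: laurent_log_add; first exact: laurent_log_term.
  exact: laurent_log_term (laurent_cst _).
exists (Num.min r s); first by rewrite lt_min r0.
move=> z z0; rewrite lt_min => /andP[h1 h2]; have zn := Re_lt0_neq0 z0.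
apply: cderive_eq (cderive_add (cderive_add (cderive_mul (HA z zn h1) (cderive_X n (cderive_logN z0)))
  (cderive_scale _ (cderive_X n.+1 (cderive_logN z0)))) (HH z z0 h2)) _.
by field; rewrite zn -natrD pnatr_eq0.
Qed.

Lemma laurent_log_prim (R : realType) (f : R[i] -> R[i]) : laurent_log f -> has_prim f.
Proof.
elim=> [|a n g la _ [G LG [s s0 HG]]].
  exists (fun=> 0); first exact: laurent_log_nil.
  by exists 1 => // z _ _; apply: cderive_cst.
have [H LH [r r0 HH]] := has_prim_term n la.
exists (fun z => H z + G z); first exact: laurent_log_add.
exists (Num.min r s); first by rewrite lt_min r0.
by move=> z z0; rewrite lt_min => /andP[h1 h2]; apply: cderive_add; [apply: HH|apply: HG].
Qed.

(** * Nested sums and summation by parts *)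

Definition zterm (R : realType) (x : int * nat) (z : R[i]) (n : nat) : R[i] :=
  cexp (z * (n * x.2)%:R) * n%:R ^ (- x.1).

Definition outer_sum (R : realType) (x : int * nat) (g : R[i] -> nat -> R[i]) z N : R[i] :=
  \sum_(j < N) zterm x z j.+1 * g z j.

(* The entries [(s_i, r_i)] are listed from the outermost index [n_1] on.  In
   [outer_sum] the index is [n_1 = j + 1], so that the inner indices are at most [j]. *)
Fixpoint nsum (R : realType) (l : seq (int * nat)) : R[i] -> nat -> R[i] :=
  if l is x :: l' then outer_sum x (nsum l') else fun _ _ => 1.
Arguments nsum : clear implicits.

(* The flag [b] tracks the case where all [s_i] are non-positive. *)
Definition adm (b : bool) (x : int * nat) := (0 < x.2)%N && (b ==> (x.1 <= 0)).

(* Laurent combinations of nested sums of depth [d], as functions on [Re z < 0]. *)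
Inductive zspan (R : realType) (b : bool) (d : nat) : (R[i] -> nat -> R[i]) -> Prop :=
| zspan_nil F : (forall z N, Re z < 0 -> F z N = 0) -> zspan b d F
| zspan_cons q l F G : laurent q -> size l = d -> all (adm b) l -> zspan b d F ->
    (forall z N, Re z < 0 -> G z N = q z * nsum R l z N + F z N) -> zspan b d G.

Lemma zspan_ext (R : realType) b d (F G : R[i] -> nat -> R[i]) : zspan b d F ->
  (forall z N, Re z < 0 -> G z N = F z N) -> zspan b d G.
Proof.
case=> [F' H|q l F' F'' lq sl al sF H] e; first by apply: zspan_nil => z N h; rewrite e ?H.
by apply: (zspan_cons (l := l) lq sl al sF) => z N h; rewrite e ?H.
Qed.

Lemma zspan_add (R : realType) b d (F G : R[i] -> nat -> R[i]) : zspan b d F -> zspan b d G ->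
  zspan b d (fun z N => F z N + G z N).
Proof.
move=> sF sG; elim: sF => [F' H|q l F' F'' lq sl al _ IH H].
  by apply: zspan_ext sG _ => z N h; rewrite H // add0r.
by apply: (zspan_cons (l := l) lq sl al IH) => z N h; rewrite H // addrA.
Qed.

Lemma zspan_scale (R : realType) b d (a : R[i] -> R[i]) (F : R[i] -> nat -> R[i]) :
  laurent a -> zspan b d F -> zspan b d (fun z N => a z * F z N).
Proof.
move=> la; elim=> [F' H|q l F' F'' lq sl al _ IH H].
  by apply: zspan_nil => z N h; rewrite H // mulr0.
by apply: (zspan_cons (l := l) (laurent_mul la lq) sl al IH) => z N h; rewrite H // mulrDr mulrA.
Qed.

Lemma zspan_nsum (R : realType) b l : all (adm b) l -> zspan b (size l) (nsum R l).
Proof.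
move=> al; apply: (zspan_cons (laurent_cst 1) (erefl _) al (zspan_nil b (size l) (F := fun _ _ => 0) _)) => //.
by move=> z N _; rewrite mul1r addr0.
Qed.

Lemma zspan_outer_sum (R : realType) b d x (F : R[i] -> nat -> R[i]) : adm b x -> zspan b d F ->
  zspan b d.+1 (outer_sum x F).
Proof.
move=> ox; elim=> [F' H|q l F' F'' lq sl al _ IH H].
  by apply: zspan_nil => z N h; rewrite /outer_sum big1 // => j _; rewrite H // mulr0.
apply: (zspan_cons (l := x :: l) lq _ _ IH) => /=; rewrite ?sl ?ox //.
move=> z N h; rewrite /outer_sum mulr_sumr -big_split /=; apply: eq_bigr => j _.
by rewrite H // mulrDr mulrCA.
Qed.

Definition expmon (R : realType) (r p : nat) (z : R[i]) (n : nat) : R[i] :=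
  cexp (z * (n * r)%:R) * n%:R ^+ p.

(* Laurent combinations of the [e^(r n z) n^p]: the discrete primitives of such functions
   have the same form. *)
Inductive exppoly (R : realType) (r : nat) : (R[i] -> nat -> R[i]) -> Prop :=
| exppoly_nil F : (forall z n, Re z < 0 -> F z n = 0) -> exppoly r F
| exppoly_cons q p F G : laurent q -> exppoly r F ->
    (forall z n, Re z < 0 -> G z n = q z * expmon r p z n + F z n) -> exppoly r G.

Lemma exppoly_ext (R : realType) r (F G : R[i] -> nat -> R[i]) : exppoly r F ->
  (forall z N, Re z < 0 -> G z N = F z N) -> exppoly r G.
Proof.
case=> [F' H|q p F' F'' lq sF H] e; first by apply: exppoly_nil => z N h; rewrite e ?H.
by apply: (exppoly_cons (p := p) lq sF) => z N h; rewrite e ?H.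
Qed.

Lemma exppoly_add (R : realType) r (F G : R[i] -> nat -> R[i]) : exppoly r F -> exppoly r G ->
  exppoly r (fun z N => F z N + G z N).
Proof.
move=> sF sG; elim: sF => [F' H|q p F' F'' lq _ IH H].
  by apply: exppoly_ext sG _ => z N h; rewrite H // add0r.
by apply: (exppoly_cons (p := p) lq IH) => z N h; rewrite H // addrA.
Qed.

Lemma exppoly_scale (R : realType) r (a : R[i] -> R[i]) (F : R[i] -> nat -> R[i]) :
  laurent a -> exppoly r F -> exppoly r (fun z N => a z * F z N).
Proof.
move=> la; elim=> [F' H|q p F' F'' lq _ IH H].
  by apply: exppoly_nil => z N h; rewrite H // mulr0.
by apply: (exppoly_cons (p := p) (laurent_mul la lq) IH) => z N h; rewrite H // mulrDr mulrA.
Qed.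

Lemma exppoly_expmon (R : realType) r p : exppoly r (@expmon R r p).
Proof.
apply: (exppoly_cons (p := p) (laurent_cst 1) (exppoly_nil r (F := fun _ _ => 0) _)) => //.
by move=> z n _; rewrite mul1r addr0.
Qed.

Lemma exppoly_sum (R : realType) r n (F : 'I_n -> R[i] -> nat -> R[i]) :
  (forall i, exppoly r (F i)) -> exppoly r (fun z N => \sum_(i < n) F i z N).
Proof.
elim: n F => [|n IH] F H; first by apply: exppoly_nil => z N _; rewrite big_ord0.
apply: exppoly_ext (exppoly_add (IH (fun i => F (widen_ord (leqnSn n) i)) _) (H ord_max)) _ => //.
by move=> z N _; rewrite big_ord_recr.
Qed.

Lemma exppoly_at0 (R : realType) r (Q : R[i] -> nat -> R[i]) : exppoly r Q ->
  exists2 q, laurent q & forall z, Re z < 0 -> Q z 0%N = q z.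
Proof.
elim=> [F H|q p F G lq _ [q' lq' H'] H].
  by exists (fun=> 0) => [|z h]; [exact: laurent_cst|rewrite H].
exists (fun z => (0 ^+ p) * q z + q' z); first by apply: laurent_add => //; apply: laurent_scale.
by move=> z h; rewrite H // H' // /expmon mul0n mulr0 cexp0 mul1r mulrC.
Qed.

(** The modulus [e^(r Re z)] is less than [1]. *)
Lemma cexp_neq1 (R : realType) (z : R[i]) (r : nat) : (0 < r)%N -> Re z < 0 ->
  cexp (r%:R * z) - 1 != 0.
Proof.
move=> r0 z0; rewrite subr_eq0; apply/eqP => e.
have := congr1 (@normc R) e; rewrite normc_cexp normc1 => /eqP; apply/negP.
rewrite lt_eqF // -expR0 ltr_expR -[r%:R]/(r%:R : R[i]).
have -> : (r%:R : R[i]) = (r%:R)%:C by rewrite rmorph_nat.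
by rewrite RecM /= mul0r subr0 nmulr_llt0 // ltr0n.
Qed.

(** With [E = e^(rz)], the difference of [E / (E - 1) E^n n^m] is
    [E^(n+1) / (E - 1) (E (n+1)^m - n^m)]. Expanding [n^m] in powers of [n+1] gives the wanted term
    plus terms of degree [p < m], which the primitives [Q p] cancel. *)
Lemma exppoly_prim (R : realType) (r m : nat) : (0 < r)%N -> exists2 Q, exppoly r Q &
  forall (z : R[i]) n, Re z < 0 -> Q z n.+1 - Q z n = expmon r m z n.+1.
Proof.
move=> r0; have [M] := ubnP m; elim: M m => // M IH m; rewrite ltnS => hm.
have {}IH (p : 'I_m) : exists Q, exppoly r Q /\
    forall (z : R[i]) n, Re z < 0 -> Q z n.+1 - Q z n = expmon r p z n.+1.
  by have [Q h1 h2] := IH p (leq_trans (ltn_ord p) hm); exists Q.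
have [Q HQ] := choice IH.
pose E (z : R[i]) := cexp (r%:R * z).
exists (fun z n => (E z * (E z - 1)^-1) * expmon r m z n +
   \sum_(p < m) ((-1) ^+ (m - p) *+ 'C(m, p) * (E z - 1)^-1) * Q p z n).
  have lE : laurent (fun z => (E z - 1)^-1) := laurent_geom R r0.
  apply: exppoly_add.
    apply: exppoly_scale (exppoly_expmon _ _ _); apply: laurent_mul lE; apply: laurent_ang.
    rewrite (_ : E = fun z => cexp z ^+ r); first exact: analytic0_X (analytic0_cexp _).
    by apply/funext => z; rewrite /E cexp_nat.
  apply: exppoly_sum => p; apply: exppoly_scale; last by case: (HQ p).
  exact: laurent_scale.
move=> z n z0; have E1 := cexp_neq1 r0 z0; rewrite -/(E z) in E1.
rewrite opprD addrACA -mulrBr -sumrB.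
under eq_bigr => p _ do rewrite -mulrBr (proj2 (HQ p)) //.
rewrite /expmon; set X := cexp (z * (n.+1 * r)%:R).
have eX : cexp (z * (n * r)%:R) * E z = X.
  rewrite -cexpD /X; congr cexp; rewrite mulSn addnC natrD; ring.
have en : (n%:R : R[i]) ^+ m = n.+1%:R ^+ m +
     \sum_(p < m) (-1) ^+ (m - p) *+ 'C(m, p) * n.+1%:R ^+ p.
  have -> : (n%:R : R[i]) = -1 + n.+1%:R by rewrite -natr1; ring.
  rewrite exprDn big_ord_recr /= subnn expr0 mul1r binn mulr1n addrC; congr (_ + _).
  by apply: eq_bigr => p _; rewrite mulrnAl.
set S := \sum_(p < m) _ in en.
have -> : \sum_(i < m) (-1) ^+ (m - i) *+ 'C(m, i) / (E z - 1) * (X * n.+1%:R ^+ i) =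
   X * (E z - 1)^-1 * S.
  by rewrite /S mulr_sumr; apply: eq_bigr => i _; ring.
have -> : E z / (E z - 1) * (X * n.+1%:R ^+ m - cexp (z * (n * r)%:R) * n%:R ^+ m) =
  (E z - 1)^-1 * X * (E z * n.+1%:R ^+ m - n%:R ^+ m) by rewrite -eX; ring.
by rewrite en; field.
Qed.

(** Only positive indices are allowed: exponents of the base [0] need not add, for instance [-1] and
    [1]. *)
Lemma zterm_expmon (R : realType) y r p (z : R[i]) n : zterm y z n.+1 * expmon r p z n.+1 =
  zterm (y.1 - p%:Z, (y.2 + r)%N) z n.+1.
Proof.
rewrite /zterm /expmon /= mulrACA -cexpD -mulrDr -natrD -mulnDr; congr (_ * _).
have n0 : (n.+1%:R : R[i]) != 0 by rewrite pnatr_eq0.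
by rewrite opprB addrC expfzDr // -exprnP.
Qed.

Lemma zspan_outer_sum_exppoly (R : realType) b d r y (Q g : R[i] -> nat -> R[i]) : exppoly r Q ->
  adm b y -> zspan b d g ->
  zspan b d.+1 (fun z N => \sum_(j < N) zterm y z j.+1 * Q z j.+1 * g z j).
Proof.
move=> PQ oy sg; elim: PQ => [F H|q p F G lq _ IH H].
  by apply: zspan_nil => z N h; rewrite big1 // => j _; rewrite H // mulr0 mul0r.
have oy' : adm b (y.1 - p%:Z, (y.2 + r)%N).
  by move: oy; rewrite /adm /=; case: b {sg IH} => /=; lia.
apply: zspan_ext (zspan_add (zspan_scale lq (zspan_outer_sum oy' sg)) IH) _ => z N h.
rewrite /outer_sum mulr_sumr -big_split /=; apply: eq_bigr => j _.
by rewrite H // -zterm_expmon; ring.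
Qed.

Lemma abel_sum (V : comPzRingType) (Q h : nat -> V) N :
  \sum_(j < N) (Q j.+1 - Q j) * h j =
  Q N * h N - Q 0%N * h 0%N - \sum_(j < N) Q j.+1 * (h j.+1 - h j).
Proof.
elim: N => [|N IH]; first by rewrite !big_ord0; ring.
by rewrite !big_ord_recr /= IH; ring.
Qed.

Lemma nsum0 (R : realType) x l (z : R[i]) : nsum R (x :: l) z 0 = 0.
Proof. by rewrite /= /outer_sum big_ord0. Qed.

Lemma nsumS (R : realType) x l (z : R[i]) N :
  nsum R (x :: l) z N.+1 - nsum R (x :: l) z N = zterm x z N.+1 * nsum R l z N.
Proof. by rewrite /= /outer_sum big_ord_recr /= [LHS]addrC addKr. Qed.

(* The boundary term [Q z N * nsum R l z N] vanishes in the limit when [x] is the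
   outermost entry, and merges with the preceding entry otherwise; for the latter the
   shifted primitive [Q'] is needed. *)
Lemma elim_head (R : realType) b x l : x.1 <= 0 -> (0 < x.2)%N -> all (adm b) l ->
  exists Q, [/\ exppoly x.2 Q,
   (exists2 Q', exppoly x.2 Q' & forall (z : R[i]) n, Re z < 0 -> Q' z n.+1 = Q z n) &
   exists2 S, zspan b (size l) S & 
    forall z N, Re z < 0 -> nsum R (x :: l) z N = Q z N * nsum R l z N + S z N].
Proof.
move=> x1 x2 al.
have [m em] : exists m : nat, - x.1 = m%:Z by exists `|x.1|%N; lia.
have [Q PQ HQ] := exppoly_prim R m x2; exists Q; split=> //.
  (* The difference equation for [Q] turns subtraction of the monomial into a shift of the index. *)
  exists (fun z n => Q z n + (-1) * expmon x.2 m z n).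
    by apply: exppoly_add PQ _; apply: exppoly_scale (exppoly_expmon _ _ _); apply: laurent_cst.
  by move=> z n h; rewrite -HQ //; ring.
exists (fun z N => - (Q z 0%N * nsum R l z 0%N) -
    \sum_(j < N) Q z j.+1 * (nsum R l z j.+1 - nsum R l z j)); last first.
  move=> z N h; rewrite addrA -abel_sum /= /outer_sum; apply: eq_bigr => j _.
  by rewrite HQ // /zterm em -exprnP.
(* For an empty tail the inner sum is constant and only the boundary term at [0] remains. Otherwise
   that term vanishes, and each increment of the inner sum is a single term of [y], into which [Q]
   merges. *)
case: l al => [|y l] al.
  have [q lq Hq] := exppoly_at0 PQ.
  apply: zspan_ext (zspan_scale (laurent_scale (-1) lq) (zspan_nsum R (b := b) (l := [::]) isT)) _ => z N h.
  rewrite /= big1 ?subr0; last by move=> j _; rewrite subrr mulr0.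
  by rewrite Hq //; ring.
have /andP[oy al'] := al.
apply: zspan_ext (zspan_scale (laurent_cst (-1)) (zspan_outer_sum_exppoly PQ oy (zspan_nsum R al'))) _ => z N h.
rewrite nsum0 mulr0 oppr0 add0r mulN1r; congr (- _); apply: eq_bigr => j _.
by rewrite nsumS; ring.
Qed.

(** [w] is the predecessor that absorbs the boundary term when the entry right after it is
    eliminated. If that entry is positive, the elimination happens further in and is carried
    outwards by linearity of [outer_sum]. *)
Lemma zspan_elim (R : realType) b w l : all (adm b) (w :: l) ->
  has (fun x => x.1 <= 0) l -> zspan b (size l) (nsum R (w :: l)).
Proof.
elim: l w => [|x l IH] w //= /and3P[ow ox al].
case: (boolP (x.1 <= 0)) => [x1 _|_ /= hl]; last first.
  by apply: zspan_outer_sum ow (IH x _ hl); rewrite /= ox.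
have x2 : (0 < x.2)%N by case/andP: ox.
have [Q [_ [Q' PQ' HQ'] [S sS HS]]] := elim_head R x1 x2 al.
apply: zspan_ext (zspan_add (zspan_outer_sum_exppoly PQ' ow (zspan_nsum R al)) (zspan_outer_sum ow sS)) _ => z N h.
(* The term of [w] has index [j + 1] while the inner sum supplies [Q z j]; [Q' z j.+1] brings both
   to the same index. *)
rewrite -[outer_sum x (nsum R l)]/(nsum R (x :: l)) [outer_sum w (nsum _ _) z N]/outer_sum [outer_sum w S z N]/outer_sum -big_split; apply: eq_bigr => j _.
rewrite HS // HQ' //=; ring.
Qed.

(** * Uniform convergence and integration *)

(** Half of the exponential pays for the polynomial: with [x = delta n / 2] one has
    [x^(p+1) <= (p+1)! e^x], whence [C]. The other half is the geometric factor. *)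
Lemma exp_poly_geo (R : realType) (p : nat) (delta : R) : 0 < delta ->
  exists A q : R, [/\ 0 <= q, q < 1 &
   forall n, n%:R ^+ p * expR (- delta * n%:R) <= A * q ^+ n].
Proof.
move=> d0; set C := (p.+1)`!%:R * (2 / delta) ^+ p.+1 : R.
have C0 : 0 <= C by rewrite mulr_ge0 // exprn_ge0 // divr_ge0 // ltW.
exists (1 + C), (expR (- (delta / 2))); split; first exact: expR_ge0.
  by rewrite expR_lt1 oppr_lt0 divr_gt0.
move=> n; set x := delta / 2 * n%:R.
have x0 : 0 <= x by rewrite mulr_ge0 // divr_ge0 // ltW.
have -> : - delta * n%:R = - x + - x by rewrite /x; field.
have -> : expR (- (delta / 2)) ^+ n = expR (- x).
  by rewrite -expRM_natl; congr expR; rewrite /x; ring.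
rewrite expRD mulrA ler_wpM2r ?expR_ge0 // expRN ler_pdivrMr ?expR_gt0 //.
have e1 : 1 <= expR x by rewrite -expR0 ler_expR.
have ex := expR_ge1Dxn p x0.
have xp : x ^+ p.+1 <= (p.+1)`!%:R * expR x.
  by rewrite mulrC -ler_pdivrMr ?ltr0n ?fact_gt0 //; lra.
have n1 : n%:R ^+ p <= 1 + n%:R ^+ p.+1 :> R.
  case: n {x x0 e1 ex xp} => [|n].
    by case: p {C C0} => [|p]; rewrite ?expr0 ?expr0n /= ?addr0 ?addr_ge0 ?lerDl ?exprn_ge0.
  rewrite exprS; have : 1 <= n.+1%:R :> R by rewrite ler1n.
  have : 0 <= n.+1%:R ^+ p :> R by rewrite exprn_ge0.
  by set a := n.+1%:R; set b := a ^+ p; nra.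
apply: le_trans n1 _; rewrite mulrDl mul1r; apply: lerD => //.
have -> : n%:R ^+ p.+1 = (2 / delta) ^+ p.+1 * x ^+ p.+1.
  by rewrite -exprMn /x; congr (_ ^+ _); field; rewrite lt0r_neq0.
have -> : C * expR x = (2 / delta) ^+ p.+1 * ((p.+1)`!%:R * expR x).
  by rewrite /C [RHS]mulrCA mulrA.
apply: ler_wpM2l => //.
by rewrite exprn_ge0 // divr_ge0 // ltW.
Qed.

Lemma Re_natM (R : realType) (z : R[i]) (n : nat) : Re (z * n%:R) = Re z * n%:R.
Proof.
have -> : (n%:R : R[i]) = (n%:R)%:C by rewrite rmorph_nat.
by rewrite RecM /= mulr0 subr0.
Qed.

(** The case [c = 0] gives the polynomial bound of [normc_nsum], and [c = delta] the decay in
    [unif_incr_nsum]. *)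
Lemma normc_zterm (R : realType) (x : int * nat) (z : R[i]) (c : R) n : (0 < x.2)%N ->
  0 <= c -> Re z <= - c ->
  normc (zterm x z n.+1) <= n.+1%:R ^+ `|x.1|%N * expR (- c * n.+1%:R).
Proof.
move=> x2 c0 hz; rewrite /zterm normcM normc_cexp mulrC.
apply: ler_pM; rewrite ?normc_ge0 ?expR_ge0 //.
  case: x.1 => m; last first.
    by rewrite NegzE opprK abszN /= -exprnP normcX normc_nat.
  rewrite -exprnN normcV normcX normc_nat /=.
  apply: (@le_trans _ _ 1); last by rewrite exprn_ege1 // ler1n.
  by rewrite invf_le1 ?exprn_ege1 ?exprn_gt0 // ?ltr0n // ler1n.
rewrite ler_expR Re_natM natrM mulrA.
have n0 : 0 <= n.+1%:R :> R by [].
have x1 : 1 <= x.2%:R :> R by rewrite ler1n.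
apply: (@le_trans _ _ (- c * n.+1%:R * x.2%:R)).
  by rewrite ler_wpM2r // ler_wpM2r.
by rewrite ler_neMr // mulNr oppr_le0 mulr_ge0.
Qed.

Definition posr (x : int * nat) := (0 < x.2)%N.

(** Polynomial growth of the inner sums suffices, because the outermost factor alone supplies
    exponential decay. *)
Lemma normc_nsum (R : realType) l : all posr l ->
  exists K, forall (z : R[i]) N, Re z <= 0 -> normc (nsum R l z N) <= N.+1%:R ^+ K.
Proof.
elim: l => [|x l IH] /=; first by move=> _; exists 0%N => z N _; rewrite normc1 expr0.
move=> /andP[px /IH [K HK]]; exists (`|x.1| + K).+1%N => z N hz.
apply: le_trans (normc_sum _) _.
apply: (@le_trans _ _ (\sum_(j < N) N.+1%:R ^+ (`|x.1| + K))); last first.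
  rewrite sumr_const card_ord exprS -[leLHS]mulr_natl.
  by apply: ler_wpM2r; rewrite ?exprn_ge0 // ler_nat.
apply: ler_sum => j _; rewrite normcM exprD.
have jN : (j.+1 <= N.+1)%N by rewrite ltnS ltnW.
apply: ler_pM; rewrite ?normc_ge0 //.
  apply: le_trans (normc_zterm (c := 0) j px (lexx 0) _) _; first by rewrite oppr0.
  by rewrite oppr0 mul0r expR0 mulr1 lerXn2r ?nnegrE // ler_nat.
by apply: le_trans (HK _ _ hz) _; rewrite lerXn2r ?nnegrE // ler_nat.
Qed.

(* Geometric convergence, uniform on each half-plane [Re z <= - delta]. *)
Definition unif_incr (R : realType) (F : R[i] -> nat -> R[i]) := forall delta : R, 0 < delta ->
  exists A q : R, [/\ 0 <= q, q < 1 &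
   forall z n, Re z <= - delta -> normc (F z n.+1 - F z n) <= A * q ^+ n].

Lemma unif_incr_nsum (R : realType) l : all posr l -> unif_incr (nsum R l).
Proof.
move=> al delta d0; case: l al => [|x l].
  by exists 0, 0; split=> // z n _; rewrite /= subrr normc0 mul0r.
move=> /andP[px pl]; have [K HK] := normc_nsum R pl.
have [A [q [q0 q1 H]]] := exp_poly_geo (`|x.1| + K) d0.
exists (A * q), q; split=> // z n hz.
rewrite nsumS normcM -mulrA -exprS; apply: le_trans (H n.+1).
rewrite exprD mulrAC; apply: ler_pM; rewrite ?normc_ge0 //.
  by apply: normc_zterm => //; apply: ltW.
apply: HK; lra.
Qed.

Lemma unif_incr_add (R : realType) (F G : R[i] -> nat -> R[i]) : unif_incr F -> unif_incr G ->
  unif_incr (fun z n => F z n + G z n).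
Proof.
move=> HF HG delta d0.
have [A [q [q0 q1 H]]] := HF _ d0; have [B [p [p0 p1 H']]] := HG _ d0.
have m0 : 0 <= Num.max q p by rewrite le_max q0.
exists (`|A| + `|B|), (Num.max q p); split=> //; first by rewrite gt_max q1.
move=> z n hz; rewrite opprD addrACA mulrDl.
apply: le_trans (le_normcD _ _) _; apply: lerD.
  apply: le_trans (H _ _ hz) _; apply: (@le_trans _ _ (`|A| * q ^+ n)).
    by rewrite ler_wpM2r ?exprn_ge0 // ler_norm.
  by rewrite ler_wpM2l // lerXn2r ?nnegrE // le_max lexx.
apply: le_trans (H' _ _ hz) _; apply: (@le_trans _ _ (`|B| * p ^+ n)).
  by rewrite ler_wpM2r ?exprn_ge0 // ler_norm.
by rewrite ler_wpM2l // lerXn2r ?nnegrE // le_max lexx orbT.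
Qed.

Lemma unif_incr_scale (R : realType) a (F : R[i] -> nat -> R[i]) : unif_incr F ->
  unif_incr (fun z n => a * F z n).
Proof.
move=> HF delta d0; have [A [q [q0 q1 H]]] := HF _ d0.
exists (normc a * A), q; split=> // z n hz.
by rewrite -mulrBr normcM -mulrA ler_wpM2l ?normc_ge0 // H.
Qed.

Lemma cvgC_uniq (R : realType) (u : nat -> R[i]) a b : cvgC u a -> cvgC u b -> a = b.
Proof.
move=> ha hb; apply/eqP; rewrite -subr_eq0 -normc_eq0 eq_le normc_ge0 andbT.
rewrite leNgt; apply/negP => e0.
have := cvgC_add ha (cvgC_scale (-1) hb); rewrite mulN1r => /cvgCE /(_ _ e0) [N].
move=> /(_ N (leqnn N)); rewrite mulN1r subrr sub0r normcN.
by rewrite ltxx.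
Qed.

Lemma unif_incr_cvg (R : realType) (F : R[i] -> nat -> R[i]) : unif_incr F ->
  forall delta : R, 0 < delta -> exists A q : R, [/\ 0 <= q, q < 1 &
   forall z, Re z <= - delta -> exists L, forall n, normc (F z n - L) <= A * q ^+ n].
Proof.
move=> HF delta d0; have [A [q [q0 q1 H]]] := HF _ d0.
exists (2 * A / (1 - q)), q; split=> // z hz.
by apply: geo_cvg => // n; apply: H.
Qed.

Fixpoint derivs (l : seq (int * nat)) : seq (nat * seq (int * nat)) :=
  if l is x :: l' then
    (x.2, (x.1 - 1, x.2) :: l') :: [seq (p.1, x :: p.2) | p <- derivs l']
  else [::].

Definition dsum (R : realType) (ps : seq (nat * seq (int * nat))) (z : R[i]) (N : nat) : R[i] :=
  \sum_(p <- ps) p.1%:R * nsum R p.2 z N.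
Arguments dsum : clear implicits.

Lemma cderive_zterm (R : realType) x (z : R[i]) n :
  cderive (fun u => zterm x u n.+1) z (x.2%:R * zterm (x.1 - 1, x.2) z n.+1).
Proof.
have n0 : (n.+1%:R : R[i]) != 0 by rewrite pnatr_eq0.
rewrite (_ : (fun u => _) = fun u => n.+1%:R ^ (- x.1) * cexp ((n.+1 * x.2)%:R * u)).
  apply: cderive_eq (cderive_scale _ (cderive_linear_comp (cderive_cexp _))) _.
  by rewrite /zterm /= opprB addrC expfzDr // expr1z natrM [z * _]mulrC; ring.
by apply/funext => u; rewrite /zterm mulrC [u * _]mulrC.
Qed.

(** The sums are finite, so the product rule applies at every [z], which is the form required by
    [integrate]. *)
Lemma cderive_nsum (R : realType) l (z : R[i]) N :
  cderive (fun u => nsum R l u N) z (dsum R (derivs l) z N).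
Proof.
elim: l z N => [|x l IH] z N; first by rewrite /dsum big_nil; apply: cderive_cst.
rewrite /dsum /= big_cons big_map /=.
have e : \sum_(p <- derivs l) p.1%:R * outer_sum x (nsum R p.2) z N =
    \sum_(j < N) zterm x z j.+1 * dsum R (derivs l) z j.
  rewrite /outer_sum; under eq_bigr do rewrite mulr_sumr.
  rewrite exchange_big; apply: eq_bigr => j _; rewrite /dsum mulr_sumr.
  by apply: eq_bigr => p _; rewrite mulrCA.
rewrite e /outer_sum mulr_sumr -big_split /=; apply: cderive_sum => j.
by apply: cderive_eq (cderive_mul (cderive_zterm x z j) (IH z j)) _; rewrite mulrA.
Qed.

(** Discs and half-planes are convex. *)
Lemma segment_bounds (R : realType) (a b : R[i]) (rho delta : R) (t : R) :
  normc a < rho -> normc b < rho -> Re a <= - delta -> Re b <= - delta -> 0 <= t <= 1 ->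
  normc (a + t%:C * (b - a)) < rho /\ Re (a + t%:C * (b - a)) <= - delta.
Proof.
move=> ha hb ra rb /andP[t0 t1].
have e : a + t%:C * (b - a) = (1 - t)%:C * a + t%:C * b.
  by rewrite rmorphB rmorph1; ring.
have t1' : 0 <= 1 - t by lra.
rewrite e; split; last by rewrite RecD !RecM /= !mul0r !subr0; nra.
apply: le_lt_trans (le_normcD _ _) _; rewrite !normcM !normc_real !ger0_norm //.
by case: (lerP t (1 / 2)) => ht; nra.
Qed.

(** The limit of [F] is never differentiated. [F_N - H] has derivative [G_N - g], which is at most
    [A q^N] on the segment from [z0] to [z], so by [MVT_C] its values at the two ends differ by a
    null sequence; [C] is read off at [z0]. *)
Lemma integrate (R : realType) (F G : R[i] -> nat -> R[i]) (g H : R[i] -> R[i]) (rho : R) :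
  0 < rho -> unif_incr F -> unif_incr G ->
  (forall z N, cderive (fun u => F u N) z (G z N)) ->
  (forall z, Re z < 0 -> normc z < rho -> cvgC (G z) (g z)) ->
  (forall z, Re z < 0 -> normc z < rho -> cderive H z (g z)) ->
  exists C, forall z, Re z < 0 -> normc z < rho -> cvgC (F z) (H z + C).
Proof.
move=> r0 uF uG DF cG DH; set z0 : R[i] := (- (rho / 2))%:C.
have rz0 : Re z0 = - (rho / 2) by [].
have nz0 : normc z0 < rho.
  by rewrite normc_real normrN ger0_norm; lra.
have [|A0 [q0 [q00 q01 H0]]] := unif_incr_cvg uF (delta := rho / 2); first by lra.
have [L HL] := H0 z0 (lexx _).
exists (L - H z0) => z hz nz.
(* The rate is uniform only away from the imaginary axis, so [delta] depends on [z] and must suit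
   both end points. *)
set delta := Num.min (- Re z) (rho / 2).
have d0 : 0 < delta by rewrite lt_min; apply/andP; split; lra.
have dz : Re z <= - delta by rewrite lerNr ge_min lexx.
have dz0 : Re z0 <= - delta by rewrite rz0 lerN2 ge_min lexx orbT.
have [A [q [Q0 Q1 HA]]] := unif_incr_cvg uG d0.
have key N : normc ((F z N - H z - (F z0 N - H z0)) - 0) <= (2 * A * normc (z - z0)) * q ^+ N.
  rewrite subr0 [X in _ <= X]mulrAC -[2 * A * _]mulrA.
  apply: (@MVT_C R (fun u => F u N - H u) (fun u => G u N - g u)) => t ht.
    have [h1 h2] := segment_bounds nz0 nz dz0 dz ht.
    by apply: cderive_sub; [apply: DF|apply: DH => //; lra].
  have [h1 h2] := segment_bounds nz0 nz dz0 dz ht.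
  set u := z0 + _ in h1 h2 *.
  have [L' HL'] := HA u h2.
  have -> : g u = L'.
    by apply: cvgC_uniq (geo_cvgC Q0 Q1 HL'); apply: cG => //; lra.
  exact: HL'.
have c1 := geo_cvgC Q0 Q1 key.
have c2 := geo_cvgC q00 q01 HL.
have c3 := cvgC_add (cvgC_add c1 c2) (cvgC_cst (H z - H z0)).
have -> : H z + (L - H z0) = 0 + L + (H z - H z0) by ring.
by apply: eq_cvgC c3 => N; ring.
Qed.

(** * Induction on the depth *)

(** The flag of [adm] also selects the class of the limit, so that one induction proves both halves
    of the theorem. *)
Definition germ (R : realType) (b : bool) (f : R[i] -> R[i]) := if b then laurent f else laurent_log f.

Lemma germ_lau (R : realType) b (f : R[i] -> R[i]) : laurent f -> germ b f.
Proof. by case: b => //; apply: laurent_log_of_lau. Qed.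

Lemma germ_add (R : realType) b (f g : R[i] -> R[i]) : germ b f -> germ b g -> germ b (fun z => f z + g z).
Proof. by case: b; [apply: laurent_add|apply: laurent_log_add]. Qed.

Lemma germ_mul (R : realType) b (q f : R[i] -> R[i]) : laurent q -> germ b f -> germ b (fun z => q z * f z).
Proof. by case: b; [apply: laurent_mul|apply: laurent_log_lau]. Qed.

Definition germ_conv (R : realType) b (F : R[i] -> nat -> R[i]) := exists2 f, germ b f &
  exists2 rho : R, 0 < rho &
    forall z, Re z < 0 -> normc z < rho -> cvgC (F z) (f z).

Lemma germ_conv_add (R : realType) b (F G H : R[i] -> nat -> R[i]) : germ_conv b F -> germ_conv b G ->
  (forall z N, Re z < 0 -> H z N = F z N + G z N) -> germ_conv b H.
Proof.
move=> [f Xf [r r0 Hf]] [g Xg [s s0 Hg]] e.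
exists (fun z => f z + g z); first exact: germ_add.
exists (Num.min r s); first by rewrite lt_min r0.
move=> z hz; rewrite lt_min => /andP[h1 h2].
by apply: eq_cvgC (cvgC_add (Hf z hz h1) (Hg z hz h2)) => N; rewrite e.
Qed.

Lemma germ_conv_mul (R : realType) b q (F : R[i] -> nat -> R[i]) : laurent q -> germ_conv b F ->
  germ_conv b (fun z N => q z * F z N).
Proof.
move=> lq [f Xf [r r0 Hf]]; exists (fun z => q z * f z); first exact: germ_mul.
by exists r => // z h1 h2; apply: cvgC_scale; apply: Hf.
Qed.

Lemma germ_conv_zero (R : realType) b (F : R[i] -> nat -> R[i]) (rho : R) : 0 < rho ->
  (forall z, Re z < 0 -> normc z < rho -> cvgC (F z) 0) -> germ_conv b F.
Proof.
move=> r0 H; exists (fun=> 0); first exact: germ_lau (laurent_cst 0).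
by exists rho.
Qed.

Lemma zspan_germ_conv (R : realType) b d (F : R[i] -> nat -> R[i]) :
  (forall l, size l = d -> all (adm b) l -> germ_conv b (nsum R l)) -> zspan b d F -> germ_conv b F.
Proof.
move=> IH; elim=> [F' H|q l F' G lq sl al _ cF H].
  apply: (@germ_conv_zero _ _ _ 1) => // z hz _.
  by apply: eq_cvgC (cvgC_cst 0) => N; rewrite H.
exact: germ_conv_add (germ_conv_mul lq (IH l sl al)) cF H.
Qed.

Lemma cvgC_mul0 (R : realType) (u h : nat -> R[i]) L : cvgC u 0 -> cvgC h L ->
  cvgC (fun n => u n * h n) 0.
Proof.
move=> /cvgCE Hu /cvgCE Hh; apply/cvgCE => e e0.
have K0 : 0 < normc L + 1 by rewrite ltr_wpDl ?normc_ge0.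
have [N HN] := Hh 1 ltr01; have [M HM] := Hu _ (divr_gt0 e0 K0).
exists (maxn N M) => n; rewrite geq_max => /andP[/HN h1 /HM].
rewrite !subr0 normcM ltr_pdivlMr //; apply: le_lt_trans.
rewrite ler_wpM2l ?normc_ge0 //.
have := normc_split (h n) L 0; rewrite !subr0; lra.
Qed.

Lemma exppoly_small (R : realType) r (Q : R[i] -> nat -> R[i]) (z : R[i]) :
  (0 < r)%N -> exppoly r Q -> Re z < 0 -> cvgC (Q z) 0.
Proof.
move=> r0 PQ hz; elim: PQ => [F H|q p F G _ _ IH H].
  by apply: eq_cvgC (cvgC_cst 0) => n; rewrite H.
have d0 : 0 < - Re z by lra.
have [A [c [c0 c1 HA]]] := exp_poly_geo p d0.
have hp : cvgC (expmon r p z) 0.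
  apply: (geo_cvgC (K := A) c0 c1) => n; rewrite subr0; apply: le_trans (HA n).
  rewrite opprK /expmon normcM normc_cexp normcX normc_nat mulrC ler_wpM2l ?exprn_ge0 //.
  rewrite ler_expR Re_natM natrM mulrA ler_neMr ?ler1n //.
  by rewrite mulr_le0_ge0 // ltW.
have := cvgC_add (cvgC_scale (q z) hp) IH; rewrite mulr0 addr0.
by apply: eq_cvgC => n; rewrite H.
Qed.

Lemma adm_posr b l : all (adm b) l -> all posr l.
Proof. by apply: sub_all => x /andP[]. Qed.

Lemma posr_adm l : all posr l -> all (adm false) l.
Proof. by apply: sub_all => x px; apply/andP. Qed.

Lemma germ_conv_nonpos (R : realType) b d w l :
  (forall l, size l = d -> all (adm b) l -> germ_conv b (nsum R l)) ->
  size l = d -> all (adm b) (w :: l) -> has (fun x => x.1 <= 0) (w :: l) ->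
  germ_conv b (nsum R (w :: l)).
Proof.
move=> IH sl al; have /andP[ow ol] := al.
case: (boolP (has (fun x => x.1 <= 0) l)) => [hl _|nl /= /orP[w1|]]; last by rewrite (negPf nl).
  by apply: zspan_germ_conv IH _; rewrite -sl; apply: zspan_elim.
have w2 : (0 < w.2)%N by case/andP: ow.
have [Q [PQ _ [S sS HS]]] := elim_head R w1 w2 ol.
(* Here the head is the only non-positive entry. For the tail only convergence is used: the
   exponentially small [Q] times a convergent sum tends to [0]. *)
rewrite sl in sS; have [f _ [rho r0 Hf]] := IH l sl ol.
apply: germ_conv_add (zspan_germ_conv IH sS) _; last by move=> z N hz; apply: HS.
apply: (germ_conv_zero b r0) => z h1 h2.
exact: cvgC_mul0 (exppoly_small w2 PQ h1) (Hf z h1 h2).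
Qed.

Definition weight (l : seq (int * nat)) := sumn [seq `|x.1|%N | x <- l].

(** Lowering [s] by one decreases [|s|] only for [s > 0], hence the condition on the weight. *)
Lemma derivs_prop l p : all posr l -> p \in derivs l ->
  [/\ size p.2 = size l, all posr p.2 &
    ~~ has (fun x => x.1 <= 0) l -> (weight p.2 < weight l)%N].
Proof.
elim: l p => [|x l IH] p //= /andP[px pl]; rewrite inE => /orP[/eqP -> /=|].
  split=> //; first by rewrite pl andbT.
  by rewrite negb_or => /andP[h _]; rewrite /weight /= ltn_add2r; lia.
move=> /mapP[p' /(IH _ pl) [h1 h2 h3] -> /=]; split; rewrite ?h1 ?px //.
by rewrite negb_or => /andP[_ /h3]; rewrite /weight /= ltn_add2l.
Qed.

Lemma germ_conv_dsum (R : realType) ps : (forall p, p \in ps -> germ_conv false (nsum R p.2)) ->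
  germ_conv false (dsum R ps).
Proof.
elim: ps => [|p ps IH] H.
  apply: (@germ_conv_zero _ _ _ 1) => // z _ _.
  by apply: eq_cvgC (cvgC_cst 0) => N; rewrite /dsum big_nil.
have c1 : germ_conv false (nsum R p.2) by apply: H; rewrite inE eqxx.
have c2 : germ_conv false (dsum R ps) by apply: IH => q hq; apply: H; rewrite inE hq orbT.
by apply: germ_conv_add (germ_conv_mul (laurent_cst p.1%:R) c1) c2 _ => z N _; rewrite /dsum big_cons.
Qed.

Lemma unif_incr_dsum (R : realType) ps : (forall p, p \in ps -> all posr p.2) ->
  unif_incr (dsum R ps).
Proof.
elim: ps => [|p ps IH] H.
  move=> delta d0; exists 0, 0; split=> // z n _.
  by rewrite /dsum !big_nil subrr normc0 mul0r.
have c1 : all posr p.2 by apply: H; rewrite inE eqxx.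
have c2 : unif_incr (dsum R ps) by apply: IH => q hq; apply: H; rewrite inE hq orbT.
have := unif_incr_add (unif_incr_scale p.1%:R (@unif_incr_nsum R _ c1)) c2.
by congr unif_incr; apply/funext => z; apply/funext => N; rewrite /dsum big_cons.
Qed.

Lemma germ_conv_integrate (R : realType) l : all posr l ->
  germ_conv false (dsum R (derivs l)) -> germ_conv false (nsum R l).
Proof.
move=> pl [g logN [r r0 Hg]]; have [H LH [s s0 HH]] := laurent_log_prim logN.
have m0 : 0 < Num.min r s by rewrite lt_min r0.
have ud : unif_incr (dsum R (derivs l)).
  by apply: unif_incr_dsum => p /(derivs_prop pl) [].
have [||C HC] := integrate (g := g) (H := H) m0 (@unif_incr_nsum R _ pl) ud (cderive_nsum l).
- by move=> z hz; rewrite lt_min => /andP[h1 _]; apply: Hg.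
- by move=> z hz; rewrite lt_min => /andP[_ h2]; apply: HH.
exists (fun z => H z + C); last by exists (Num.min r s).
by apply: laurent_log_add LH _; apply: laurent_log_of_lau (laurent_cst C).
Qed.

Lemma germ_conv_nsum (R : realType) b l : all (adm b) l -> germ_conv b (nsum R l).
Proof.
move: {2}(size l) (erefl (size l)) => d.
elim: d l => [|d IH] l.
  move=> /size0nil -> _; exists (fun=> 1); first exact: germ_lau (laurent_cst 1).
  by exists 1 => // z _ _; apply: cvgC_cst.
case: b IH => IH sl al.
  case: l sl al => // w l [sl] al; have w1 : w.1 <= 0 by case/andP: al => /andP[].
  by apply: germ_conv_nonpos IH sl al _; rewrite /= w1.
(* Differentiating lowers the weight until some [s_i] reaches [0], where [germ_conv_nonpos] takes
   over. *)
have [M] := ubnP (weight l); elim: M l sl al => // M IHM l sl al hM.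
case: (boolP (has (fun x => x.1 <= 0) l)) => hl.
  by case: l sl al hl hM => // w l [sl] al hl _; apply: germ_conv_nonpos IH sl al hl.
have pl := adm_posr al.
apply: germ_conv_integrate => //; apply: germ_conv_dsum => p /(derivs_prop pl) [h1 h2 /(_ hl) h3].
by apply: IHM; rewrite ?h1 //; [apply: posr_adm|apply: leq_trans h3 hM].
Qed.

(* With a fixed bound [B] on the type of the indices and a variable bound [M] on their
   values, the recursion on the depth stays within one type. *)
Definition decr (B k M : nat) (n : {ffun 'I_k -> 'I_B.+1}) :=
  [&& [forall i : 'I_k, forall j : 'I_k, (i < j)%N ==> (n j < n i)%N],
      [forall i : 'I_k, (0 < n i)%N] & [forall i : 'I_k, (n i <= M)%N]].

Definition fcons (T : finType) k (a : T) (n : {ffun 'I_k -> T}) : {ffun 'I_k.+1 -> T} :=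
  [ffun i => if unlift ord0 i is Some j then n j else a].

Lemma fcons0 (T : finType) k (a : T) (n : {ffun 'I_k -> T}) : fcons a n ord0 = a.
Proof. by rewrite ffunE unlift_none. Qed.

Lemma fconsS (T : finType) k (a : T) (n : {ffun 'I_k -> T}) j :
  fcons a n (lift ord0 j) = n j.
Proof. by rewrite ffunE liftK. Qed.

(** By strict decrease only the first index feels [M]; the others are bounded by [a.-1], the bound
    of the inner sum in [outer_sum]. *)
Lemma decr_fcons B k M (a : 'I_B.+1) (n : {ffun 'I_k -> 'I_B.+1}) :
  decr M (fcons a n) = (0 < a <= M)%N && decr a.-1 n.
Proof.
apply/idP/idP.
  move=> /and3P[/forallP h1 /forallP h2 /forallP h3].
  have := h2 ord0; have := h3 ord0; rewrite fcons0 => -> -> /=.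
  apply/and3P; split; apply/forallP => i.
  - apply/forallP => j; apply/implyP => ij.
    have := forallP (h1 (lift ord0 i)) (lift ord0 j).
    by rewrite !fconsS !lift0 ltnS ij.
  - by have := h2 (lift ord0 i); rewrite fconsS.
  - have := forallP (h1 ord0) (lift ord0 i); rewrite fcons0 fconsS lift0 /=; lia.
move=> /andP[/andP[a0 aM] /and3P[/forallP h1 /forallP h2 /forallP h3]].
apply/and3P; split; apply/forallP => i.
- apply/forallP => j; apply/implyP.
  case: (unliftP ord0 i) => [i'|] ->; case: (unliftP ord0 j) => [j'|] ->;
    rewrite ?fcons0 ?fconsS ?lift0 // ?ltnS.
    by move=> ij; have := forallP (h1 i') j'; rewrite ij.
  by move=> _; rewrite -(prednK a0) ltnS; apply: h3.
- by case: (unliftP ord0 i) => [i'|] ->; rewrite ?fcons0 ?fconsS.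
- case: (unliftP ord0 i) => [i'|] ->; rewrite ?fcons0 ?fconsS //.
  by apply: leq_trans (h3 i') (leq_trans (leq_pred _) aM).
Qed.

Lemma sum_decr (R : realType) (B k : nat) (s : 'I_k -> int) (r : 'I_k -> nat) (z : R[i]) M :
  (M <= B)%N ->
  \sum_(n : {ffun 'I_k -> 'I_B.+1} | decr M n)
     cexp (z * (\sum_(i < k) (n i * r i)%N%:R)) * \prod_(i < k) (((n i)%:R : R[i]) ^ (- s i))
  = nsum R [seq (s i, r i) | i <- enum 'I_k] z M.
Proof.
elim: k s r M => [|k IH] s r M MB.
  have u (n : {ffun 'I_0 -> 'I_B.+1}) : n = [ffun=> ord0] by apply/ffunP => -[].
  rewrite enum_ord0 /= (big_pred1 [ffun=> ord0]).
    by rewrite !big_ord0 mulr0 cexp0 mulr1.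
  move=> n; rewrite /= (u n) eqxx; apply/and3P.
  by split; apply/forallP => -[].
rewrite enum_ordSl /= -map_comp.
pose G (a : nat) := zterm (s ord0, r ord0) z a *
   nsum R [seq (s (lift ord0 i), r (lift ord0 i)) | i <- enum 'I_k] z a.-1.
transitivity (\sum_(a : 'I_B.+1 | (0 < a <= M)%N) G a).
  rewrite (reindex (fun p : 'I_B.+1 * {ffun 'I_k -> 'I_B.+1} => fcons p.1 p.2)) /=; last first.
    apply: onW_bij; exists (fun n : {ffun 'I_k.+1 -> 'I_B.+1} =>
      (n ord0, [ffun j : 'I_k => n (lift ord0 j)])).
      move=> [a n]; rewrite fcons0; congr (_, _).
      by apply/ffunP => j; rewrite ffunE fconsS.
    move=> n; apply/ffunP => i; rewrite ffunE.
    by case: unliftP => [j|] -> //; rewrite ffunE.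
  under eq_bigl do rewrite decr_fcons.
  rewrite -(pair_big_dep (fun a : 'I_B.+1 => (0 < a <= M)%N) (fun a n => decr a.-1 n)
    (fun a n => cexp (z * \sum_(i < k.+1) (fcons a n i * r i)%N%:R) *
      \prod_(i < k.+1) ((fcons a n i)%:R ^ (- s i)))) /=.
  apply: eq_bigr => a /andP[a0 aM].
  rewrite /G -IH; last by have := ltn_ord a; lia.
  rewrite mulr_sumr; apply: eq_bigr => n _.
  rewrite !big_ord_recl fcons0.
  under eq_bigr do rewrite fconsS.
  have -> : \prod_(i < k) ((fcons a n (lift ord0 i))%:R : R[i]) ^ (- s (lift ord0 i)) =
      \prod_(i < k) (n i)%:R ^ (- s (lift ord0 i)).
    by apply: eq_bigr => i _; rewrite fconsS.
  by rewrite mulrDr cexpD /zterm /= mulrACA.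
(* The index [a = 0] is excluded, and [a = j + 1] is the shift built into [outer_sum]. *)
rewrite big_mkcond big_ord_recl /= add0r -big_mkcond /=.
by rewrite /outer_sum (big_ord_widen B (fun j => zterm (s ord0, r ord0) z j.+1 * _ z j) MB).
Qed.

Lemma Zpartial_nsum (R : realType) k (s : 'I_k -> int) (r : 'I_k -> nat) (z : R[i]) N :
  Zpartial s r z N = nsum R [seq (s i, r i) | i <- enum 'I_k] z N.
Proof.
rewrite -(sum_decr s r z (leqnn N)); apply: eq_bigl => n.
(* For [M = B = N] the additional bound in [decr] holds by the type of the indices. *)
rewrite /decr; congr (_ && _); rewrite -[LHS]andbT; congr (_ && _); apply/esym/forallP => i.
by rewrite -ltnS.
Qed.

Lemma germ_conv_Zsum (R : realType) b k (s : 'I_k -> int) (r : 'I_k -> nat) :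
  (forall i, adm b (s i, r i)) -> exists2 f : R[i] -> R[i], germ b f & exists2 rho : R, 0 < rho &
    forall eps, Re eps < 0 -> `|eps| < rho%:C -> Zsum_is s r eps (f eps).
Proof.
move=> h; have [|f Xf [rho r0 H]] := @germ_conv_nsum R b [seq (s i, r i) | i <- enum 'I_k].
  by apply/allP => _ /mapP[i _ ->].
exists f => //; exists rho => // eps h1; rewrite normcE_norm ltcR => h2.
by apply: eq_cvgC (H eps h1 h2) => N; rewrite Zpartial_nsum.
Qed.

Theorem theorem3p3 (R : realType) (k : nat) (s : 'I_k -> int)
    (r : 'I_k -> nat) (hr : forall i : 'I_k, (0 < r i)%N) :
  (exists (M : nat) (a : nat -> R[i] -> R[i]) (rho : R),
      0 < rho /\ (forall n : nat, is_conv_laurent (a n)) /\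
      forall eps : R[i], complex.Re eps < 0 -> `|eps| < rho%:C ->
        Zsum_is s r eps (\sum_(n < M.+1) a n eps * clog (- eps) ^+ n))
  /\
  ((forall i : 'I_k, s i <= 0) ->
    exists (a : R[i] -> R[i]) (rho : R),
      0 < rho /\ is_conv_laurent a /\
      forall eps : R[i], complex.Re eps < 0 -> `|eps| < rho%:C ->
        Zsum_is s r eps (a eps)).
Proof.
split=> [|hs].
  have [|f Lf [rho r0 H]] := @germ_conv_Zsum R false k s r; first by move=> i; rewrite /adm hr.
  have [M [a [la Ha]]] := laurent_log_final Lf.
  exists M, a, rho; split=> //; split=> [n|eps h1 h2]; first exact: laurent_conv.
  by rewrite -Ha //; apply: H.
have [|f lf [rho r0 H]] := @germ_conv_Zsum R true k s r; first by move=> i; rewrite /adm hr hs.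
by exists f, rho; split=> //; split=> //; apply: laurent_conv.
Qed.
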